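(* Let $f\in\mathrm{LC}$ satisfy (H$_1$), (H$_3$) and (H$_2^\bullet$) there are $\alpha_1>0$ and $K\ge1$ with $\exp\big(\int_s^t\alpha(u)du\big)\le Ke^{-\alpha_1(t-s)}$ for all $s\le t$. Then there is a bounded set $B\subset\mathbb R^N$ such that for every bounded $D\subset\mathbb R^N$ there is $T(D)>0$ with $S_f(t,t-s)D\subset B$ for all $t\in\mathbb R$ and $s\ge T(D)$; hence the process $S_f$ has a bounded pullback attractor.
   Context: $\mathrm{LC}$: Borel measurable $f:\mathbb R\times\mathbb R^N\to\mathbb R^N$ such that for every compact $K$ there are $m^K,l^K\in L^1_{loc}$ with $|f(t,x)|\le m^K(t)$ and $|f(t,x)-f(t,y)|\le l^K(t)|x-y|$ for $x,y\in K$, a.e. $t$. (H$_1$): there exist $\alpha,\beta\in L^1_{loc}$ with $\beta\ge0$ such that $2\langle f(t,x),x\rangle\le\alpha(t)|x|^2+\beta(t)$ for a.e. $(t,x)\in\mathbb R^{1+N}$. (H$_3$): $\sup_{t\in\mathbb R}\int_{-r}^r\beta(s+t)ds<\infty$ for every $r>0$. Under (H$_1$) solutions of $\dot x=f(t,x)$, $x(r)=x_0$ exist on $[r,\infty)$; the process is $S_f(t,r)x_0=$ value at $t\ge r$ of that solution. A pullback attractor of a process $S$ on $\mathbb R^N$ is a family $\{\mathcal A(t)\}_{t\in\mathbb R}$ of compact sets with $S(t,s)\mathcal A(s)=\mathcal A(t)$ for $t\ge s$, $\lim_{s\to-\infty}\mathrm{dist}(S(t,s)D,\mathcal A(t))=0$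 for every bounded $D$ and $t$ (Hausdorff semi-distance), and minimal among closed families with this property; it is bounded if $\bigcup_t\mathcal A(t)$ is bounded. *)

(* Defs.v *)
From HB Require Import structures.
From mathcomp Require Import all_boot all_order all_algebra.
From mathcomp Require Import all_classical all_reals all_analysis.
Set Implicit Arguments. Unset Strict Implicit. Unset Printing Implicit Defensive.
Import Order.TTheory GRing.Theory Num.Theory.
Import numFieldNormedType.Exports.
Local Open Scope classical_set_scope.
Local Open Scope ring_scope.

(* R^N is represented by row vectors 'rV[R]_N; entry i of x is x ord0 i.
   The topology (open/compact) is the standard one. *)

Definition edot {R : realType} {N : nat} (x y : 'rV[R]_N) : R :=
  \sum_(i < N) x ord0 i * y ord0 i.
Definition enorm {R : realType} {N : nat} (x : 'rV[R]_N) : R :=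
  Num.sqrt (edot x x).

Definition ebounded {R : realType} {N : nat} (B : set 'rV[R]_N) : Prop :=
  exists M : R, forall x, B x -> enorm x <= M.

Notation leb R := (@lebesgue_measure R).

Definition loc_integrable {R : realType} (m : R -> R) : Prop :=
  forall a b : R, (leb R).-integrable `[a, b]%classic (EFin \o m).

Definition borel_fun {R : realType} {N : nat}
  (f : R -> 'rV[R]_N -> 'rV[R]_N) : Prop :=
  forall U : set 'rV[R]_N, open U ->
    <<s [set A : set (R * 'rV[R]_N)%type | open A] >>
      [set p | U (f p.1 p.2)].

Definition box {R : realType} {N : nat} (a b : R) (l u : 'rV[R]_N)
  : set (R * 'rV[R]_N)%type :=
  [set p : (R * 'rV[R]_N)%type | a <= p.1 <= b /\ forall i, l ord0 i <= p.2 ord0 i <= u ord0 i].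
Definition box_vol {R : realType} {N : nat} (a b : R) (l u : 'rV[R]_N) : R :=
  (b - a) * \prod_(i < N) (u ord0 i - l ord0 i).
Definition null_set_R1N {R : realType} {N : nat}
  (E : set (R * 'rV[R]_N)%type) : Prop :=
  forall eps : R, 0 < eps ->
    exists (a b : nat -> R) (l u : nat -> 'rV[R]_N),
      (forall n, a n <= b n /\ forall i, l n ord0 i <= u n ord0 i) /\
      E `<=` \bigcup_n box (a n) (b n) (l n) (u n) /\
      (forall n, \sum_(k < n) box_vol (a k) (b k) (l k) (u k) <= eps).

Definition LC {R : realType} {N : nat} (f : R -> 'rV[R]_N -> 'rV[R]_N) : Prop :=
  borel_fun f /\
  forall K : set 'rV[R]_N, compact K ->
    exists m l : R -> R, loc_integrable m /\ loc_integrable l /\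
      {ae leb R, forall t, forall x y, K x -> K y ->
          enorm (f t x) <= m t /\
          enorm (f t x - f t y) <= l t * enorm (x - y)}.

Definition H1 {R : realType} {N : nat} (f : R -> 'rV[R]_N -> 'rV[R]_N)
  (alpha beta : R -> R) : Prop :=
  loc_integrable alpha /\ loc_integrable beta /\ (forall t, 0 <= beta t) /\
  null_set_R1N [set p : (R * 'rV[R]_N)%type |
     ~ (2 * edot (f p.1 p.2) p.2 <= alpha p.1 * enorm p.2 ^+ 2 + beta p.1)].

Definition H3 {R : realType} (beta : R -> R) : Prop :=
  forall r : R, 0 < r -> exists M : R, forall t : R,
    Rintegral (leb R) `[- r, r]%classic (fun s => beta (s + t)) <= M.

Definition H2b {R : realType} (alpha : R -> R) : Prop :=
  exists alpha1 K : R, 0 < alpha1 /\ 1 <= K /\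
    forall s t : R, s <= t ->
      expR (Rintegral (leb R) `[s, t]%classic alpha)
        <= K * expR (- alpha1 * (t - s)).

(* Caratheodory solution of x' = f(t,x), x(r) = x0 on [r, oo). *)
Definition is_solution {R : realType} {N : nat} (f : R -> 'rV[R]_N -> 'rV[R]_N)
  (r : R) (x0 : 'rV[R]_N) (x : R -> 'rV[R]_N) : Prop :=
  x r = x0 /\
  forall t, r <= t -> forall i : 'I_N,
    (leb R).-integrable `[r, t]%classic (fun s => (f s (x s) ord0 i)%:E) /\
    x t ord0 i = x0 ord0 i + Rintegral (leb R) `[r, t]%classic
                                 (fun s => f s (x s) ord0 i).

(* The process S_f(t, r) x0 : the value at t >= r of the solution
   (which exists and is unique under LC and (H1)). *)
Definition Sf {R : realType} {N : nat} (f : R -> 'rV[R]_N -> 'rV[R]_N)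
  (t r : R) (x0 : 'rV[R]_N) : 'rV[R]_N :=
  match pselect (exists x, is_solution f r x0 x) with
  | left e => (proj1_sig (cid e)) t
  | right _ => x0
  end.

(* Hausdorff semi-distance dist(X, Y) = sup_{x in X} inf_{y in Y} |x - y|
   (with the convention dist(emptyset, Y) = 0). *)
Definition hsemidist {R : realType} {N : nat} (X Y : set 'rV[R]_N) : \bar R :=
  ereal_sup ([set 0%E] `|`
    [set ereal_inf [set (enorm (x - y))%:E | y in Y] | x in X]).

Definition pullback_attracts {R : realType} {N : nat}
  (S : R -> R -> 'rV[R]_N -> 'rV[R]_N) (C : R -> set 'rV[R]_N) : Prop :=
  forall D : set 'rV[R]_N, ebounded D -> forall t : R,
    (fun s => hsemidist (S t s @` D) (C t)) @ -oo --> 0%E.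

Definition pullback_attractor {R : realType} {N : nat}
  (S : R -> R -> 'rV[R]_N -> 'rV[R]_N) (A : R -> set 'rV[R]_N) : Prop :=
  (forall t, compact (A t)) /\
  (forall t s, s <= t -> S t s @` A s = A t) /\
  pullback_attracts S A /\
  (forall C : R -> set 'rV[R]_N, (forall t, closed (C t)) ->
     pullback_attracts S C -> forall t, A t `<=` C t).

Definition bounded_pullback_attractor {R : realType} {N : nat}
  (S : R -> R -> 'rV[R]_N -> 'rV[R]_N) (A : R -> set 'rV[R]_N) : Prop :=
  pullback_attractor S A /\ ebounded (\bigcup_t A t).

(* Main.v *)
Require Import Defs.
From HB Require Import structures.
From mathcomp Require Import all_boot all_order all_algebra.
From mathcomp Require Import all_classical all_reals all_analysis.
From mathcomp Require Import measurable_realfun lra.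
Set Implicit Arguments. Unset Strict Implicit. Unset Printing Implicit Defensive.
Import Order.TTheory GRing.Theory Num.Theory.
Import numFieldNormedType.Exports.
Local Open Scope classical_set_scope.
Local Open Scope ring_scope.

(** The energy u = |x|^2 of a solution satisfies u' <= alpha u + beta, so by
    Gronwall and (H2) u(t) <= K e^{-a1 (t - s)} u(s) + K \int_s^t beta.  Over a
    time L with K e^{-a1 L} <= 1/2 the energy is halved up to a constant that is
    uniform in time by (H3); iterating gives one ball B absorbing every bounded
    set uniformly.  The attractor is A(t) = \bigcap_(s <= t) S(t, s) B, an
    essentially decreasing intersection of compact sets.

    Differential inequalities between primitives of integrable functions are
    proved without differentiating: a function that is nonincreasing on a
    neighbourhood of every point is nonincreasing, and on short intervals the
    continuous factors of an integrand can be frozen up to a small error.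

    Solutions are global because f(t, x) may be replaced by f(t, P x), P the
    radial retraction onto a large ball: Picard iteration solves the modified
    equation, and the energy bound, which does not depend on the radius, shows
    that the solution never leaves the ball.

    (H1) holds for almost every (t, x) only; a Fubini argument for boxes makes
    the good x dense for almost every t, and continuity of f(t, .) extends the
    inequality to all x. *)

(** * Integrals over intervals *)

Section IntervalIntegrals.
Context {R : realType}.
Local Notation mu := (@lebesgue_measure R).
Implicit Types (h a b : R -> R) (s t u : R).

Lemma ae_leb_imp (P Q : R -> Prop) : (forall x, P x -> Q x) ->
  {ae mu, forall x, P x} -> {ae mu, forall x, Q x}.
Proof.
move=> PQ; apply: filterS; first exact: (ae_filter_ringOfSetsType mu).
exact: PQ.
Qed.

Lemma ae_leb_and (P Q : R -> Prop) : {ae mu, forall x, P x} ->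
  {ae mu, forall x, Q x} -> {ae mu, forall x, P x /\ Q x}.
Proof. by apply: filterI; exact: (ae_filter_ringOfSetsType mu). Qed.

(** Discards the error left by freezing continuous factors: it is [e] times a constant [c] fixed in
    advance. Taking [e / (|c| + 1)] covers [c] of any sign. *)
Lemma ler_mul_eps (x y c : R) : (forall e, 0 < e -> x <= y + e * c) -> x <= y.
Proof.
move=> H; apply/ler_addgt0Pr => e e0.
have c0 : 0 < `|c| + 1 by rewrite ltr_pwDr.
apply: le_trans (H (e / (`|c| + 1)) (divr_gt0 e0 c0)) _.
rewrite lerD2l -mulrA ler_piMr ?(ltW e0)// mulrC ler_pdivrMr// mul1r.
by rewrite (le_trans (ler_norm c))// lerDl.
Qed.

(** Let [m] be the supremum of the points of [[s, t]] at which [phi] is at most [phi s]. The local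
    hypothesis at [m] puts [m] itself in that set, and a point to its right as well if [m < t]. *)
Lemma locally_nonincreasing_le (phi : R -> R) s t : s <= t ->
  (forall z, s <= z <= t -> exists2 d, 0 < d & forall x y,
     s <= x -> x <= y -> y <= t -> z - d < x -> y < z + d -> phi y <= phi x) ->
  phi t <= phi s.
Proof.
move=> st H; pose S := [set x | s <= x <= t /\ phi x <= phi s].
have Ss : S s by split; rewrite ?lexx.
have ubS : ubound S t by move=> x [/andP[]].
have supS : has_sup S by split; [exists s|exists t].
pose m := sup S.
have sm : s <= m by apply: ub_le_sup Ss; exists t.
have mt : m <= t by apply: ge_sup => //; exists s.
have [d d0 Hd] : exists2 d, 0 < d & forall x y, s <= x -> x <= y -> y <= t ->
    m - d < x -> y < m + d -> phi y <= phi x by apply: H; rewrite sm mt.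
have [x [/andP[sx xt] px] mx] := sup_adherent d0 supS.
have xm : x <= m by apply: ub_le_sup; [exists t|split => //; rewrite sx].
have pm : phi m <= phi s.
  by apply: le_trans px; apply: Hd => //; rewrite ltrDl.
move: mt; rewrite le_eqVlt => /predU1P[<-//|mt].
pose y := Num.min t (m + d / 2).
have my : m < y by rewrite lt_min mt ltrDl divr_gt0.
have yt : y <= t by rewrite ge_min lexx.
have : y <= m.
  apply: ub_le_sup; first by exists t.
  split; first by rewrite yt (le_trans sm (ltW my)).
  apply: le_trans pm; apply: Hd => //; [exact: ltW| by rewrite ltrBlDr ltrDl|].
  by rewrite gt_min; apply/orP; right; rewrite ltrD2l ltr_pdivrMr// ltr_pMr// ltr1n.
by rewrite leNgt my.
Qed.

Lemma loc_integrableD a b : loc_integrable a -> loc_integrable b ->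
  loc_integrable (fun x => a x + b x).
Proof.
by move=> ia ib x y; apply: (integrableD _ (ia x y) (ib x y)).
Qed.

Lemma loc_integrableZ k a : loc_integrable a ->
  loc_integrable (fun x => k * a x).
Proof. by move=> ia x y; apply: (integrableZl _ k (ia x y)). Qed.

Lemma loc_integrableB a b : loc_integrable a -> loc_integrable b ->
  loc_integrable (fun x => a x - b x).
Proof.
by move=> ia ib x y; apply: (integrableB _ (ia x y) (ib x y)).
Qed.

Lemma loc_integrable_norm a : loc_integrable a ->
  loc_integrable (fun x => `|a x|).
Proof. by move=> ia x y; exact: integrable_norm. Qed.

Lemma loc_integrable_cst c : loc_integrable (fun _ : R => c).
Proof.
move=> x y; apply: continuous_compact_integrable; first exact: segment_compact.
by apply: continuous_subspaceT => z; exact: cvg_cst.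
Qed.

Lemma loc_integrable_sum (I : Type) (r : seq I) (h : I -> R -> R) :
  (forall i, loc_integrable (h i)) ->
  loc_integrable (fun x => \sum_(i <- r) h i x).
Proof.
move=> ih; elim: r => [|i r IH].
  have := loc_integrable_cst 0; congr loc_integrable.
  by apply/funext => x; rewrite big_nil.
have := loc_integrableD (ih i) IH; congr loc_integrable.
by apply/funext => x; rewrite big_cons.
Qed.

Lemma loc_integrableM a (c : R -> R) : loc_integrable a -> continuous c ->
  loc_integrable (fun x => a x * c x).
Proof.
move=> ia cc x y.
apply: (@integrableMl _ _ _ mu _ _ (EFin \o a) c) => //.
  by apply: measurable_funTS; exact: continuous_measurable_fun.
have [M [Mr HM]] : bounded_set (c @` `[x, y]).
  apply: compact_bounded; apply: continuous_compact.
    exact: continuous_subspaceT.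
  exact: segment_compact.
by exists M; split => // K MK z xz; apply: HM => //; exists z.
Qed.

Lemma loc_integrable_le h m : measurable_fun setT h -> loc_integrable m ->
  {ae mu, forall x, `|h x| <= m x} -> loc_integrable h.
Proof.
move=> mh im hm x y; apply/integrableP; split.
  by apply/measurable_EFinP; exact: measurable_funTS.
have /integrableP[mm] := loc_integrable_norm im x y; apply: le_lt_trans.
apply: ae_ge0_le_integral => //.
- apply: measurableT_comp => //; apply/measurable_EFinP.
  exact: measurable_funTS.
- exact: measurableT_comp.
- apply: ae_leb_imp hm => z hz _ /=; rewrite lee_fin normr_id.
  exact: le_trans hz (ler_norm _).
Qed.

Lemma le_Rintegral_ae h m s t : loc_integrable h -> loc_integrable m ->
  {ae mu, forall x, s <= x <= t -> h x <= m x} ->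
  \int[mu]_(x in `[s, t]) h x <= \int[mu]_(x in `[s, t]) m x.
Proof.
move=> ih im hm; pose m' x := Num.max (h x) (m x).
have mhE : measurable_fun `[s, t] h.
  by apply/measurable_EFinP; exact: measurable_int (ih s t).
have mmE : measurable_fun `[s, t] m.
  by apply/measurable_EFinP; exact: measurable_int (im s t).
have im' : mu.-integrable `[s, t] (EFin \o m').
  have m'E x : m' x = 2^-1 * (h x + m x) + 2^-1 * `|h x - m x|.
    by rewrite /m' -mulrDr maxr_absE mulrC.
  have := loc_integrableD (loc_integrableZ 2^-1 (loc_integrableD ih im))
     (loc_integrableZ 2^-1 (loc_integrable_norm (loc_integrableB ih im))).
  by move=> /(_ s t); congr (mu.-integrable _ _); apply/funext => x /=; rewrite m'E.
have -> : \int[mu]_(x in `[s, t]) m x = \int[mu]_(x in `[s, t]) m' x.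
  congr fine; apply: ae_eq_integral => //.
  - exact/measurable_EFinP.
  - exact: measurable_int im'.
  - apply: ae_leb_imp hm => x hx xst /=; congr EFin; rewrite /m'.
    by apply/esym/max_idPr/hx; move: xst; rewrite /= in_itv.
apply: le_Rintegral => //.
by move=> x _; rewrite /m' le_max lexx.
Qed.

Lemma Rintegral_itvD h s t u : loc_integrable h -> s <= t -> t <= u ->
  \int[mu]_(x in `[s, u]) h x =
  \int[mu]_(x in `[s, t]) h x + \int[mu]_(x in `[t, u]) h x.
Proof.
move=> ih st tu; have := @Rintegral_itvB R h (BLeft s) (BRight u) t (ih s u).
rewrite !bnd_simp => /(_ st tu); rewrite Rintegral_itv_obnd_cbnd.
  by move=> <-; rewrite addrC subrK.
by apply: integrableS (ih s u) => //; apply: subset_itv; rewrite bnd_simp.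
Qed.

Lemma Rintegral_itv_ge0 h s t : (forall x, 0 <= h x) ->
  0 <= \int[mu]_(x in `[s, t]) h x.
Proof. by move=> h0; apply: Rintegral_ge0. Qed.

Lemma Rintegral_itv_gt h s t : t < s -> \int[mu]_(x in `[s, t]) h x = 0.
Proof. by move=> ts; rewrite set_itv_ge ?Rintegral_set0// bnd_simp -ltNge. Qed.

(** Integrals over reversed intervals are 0, so a primitive based at [s] is constant to the left of
    [s]. *)
Lemma Rintegral_itv_max h s t :
  \int[mu]_(x in `[s, t]) h x = \int[mu]_(x in `[s, Num.max s t]) h x.
Proof.
have [st|ts] := leP s t => //.
by rewrite Rintegral_itv_gt// set_itv1 Rintegral_set1.
Qed.

Lemma Rintegral_itv_continuous h s : loc_integrable h ->
  continuous (fun t => \int[mu]_(x in `[s, t]) h x).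
Proof.
move=> ih t; pose a := Num.min s t - 1; pose b := Num.max s t + 1.
have as_ : a <= s by rewrite lerBlDr (@le_trans _ _ s) ?ge_min ?lexx// lerDl.
(* Factoring through [max s] moves the base point to [a], strictly left of both [s] and [t], so that
   only continuity at an interior point of [[a, b]] is used. *)
have E : (fun t => \int[mu]_(x in `[s, t]) h x) =
  (fun t => \int[mu]_(x in `[a, t]) h x - \int[mu]_(x in `[a, s]) h x) \o Num.max s.
  apply/funext => z /=; rewrite Rintegral_itv_max (Rintegral_itvD ih as_).
    by rewrite addrAC subrr add0r.
  by rewrite le_max lexx.
rewrite E; apply: continuous_comp.
  by apply: continuous_max; [exact: cvg_cst | exact: cvg_id].
apply: continuousB; last exact: cvg_cst.
have mab : a < Num.max s t < b.
  rewrite ltrDl ltr01 andbT ltrBlDr (@le_lt_trans _ _ (Num.max s t)) ?ltrDl//.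
  by rewrite ge_min le_max lexx.
have ab : a < b by case/andP: mab; exact: lt_trans.
have := @parameterized_integral_continuous R a b h (ltW ab) (ih a b).
by move=> /(continuous_within_itvP _ ab)[H _ _]; apply: H; rewrite in_itv.
Qed.

End IntervalIntegrals.

(** * Gronwall inequality *)

Section Gronwall.
Context {R : realType}.
Local Notation mu := (@lebesgue_measure R).
Implicit Types (h a b : R -> R) (s t u : R).

Lemma continuous_osc (x : R -> R) z e : continuous x -> 0 < e ->
  exists2 d, 0 < d & forall p q, z - d < p -> p < z + d -> z - d < q ->
    q < z + d -> `|x p - x q| <= e.
Proof.
move=> cx e0; have e2 : 0 < e / 2 by rewrite divr_gt0.
have /cvgrPdist_lt /(_ _ e2) /nbhs_ballP[d /= d0 H] := cx z.
have Hd y : z - d < y -> y < z + d -> `|x z - x y| < e / 2.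
  by move=> y1 y2; apply: H; rewrite /ball /= ltr_distlC y1 y2.
exists d => // p q p1 p2 q1 q2.
have -> : x p - x q = (x z - x q) - (x z - x p) by lra.
rewrite (le_trans (ler_normB _ _))// [leRHS](splitr e) lerD// ltW// Hd//.
Qed.

(* Integration by parts for x^2 is avoided: on short intervals
   x(t)^2 - x(s)^2 = (x(s) + x(t)) * \int h differs from \int 2 h x by at most
   the oscillation of x times 2 \int |h|. *)
Lemma primitive_sqr_le (x h : R -> R) s t : continuous x -> loc_integrable h ->
  s <= t ->
  (forall p q, s <= p -> p <= q -> q <= t ->
     x q - x p = \int[mu]_(z in `[p, q]) h z) ->
  x t ^+ 2 - x s ^+ 2 <= \int[mu]_(z in `[s, t]) (2 * (h z * x z)).
Proof.
move=> cx ih st xh.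
have ihx : loc_integrable (fun z => 2 * (h z * x z)).
  by apply: loc_integrableZ; exact: loc_integrableM.
apply: (@ler_mul_eps _ _ _ (2 * \int[mu]_(z in `[s, t]) `|h z|)) => e e0.
(* The term with [|h z|] pays for replacing [2 * x z] by [x p + x q] on a short interval, where each
   difference is at most [e]. *)
pose k z := 2 * (h z * x z) + 2 * e * `|h z|.
have ik : loc_integrable k.
  by apply: loc_integrableD => //; apply: loc_integrableZ; exact: loc_integrable_norm.
suff : x t ^+ 2 - \int[mu]_(z in `[s, t]) k z <=
       x s ^+ 2 - \int[mu]_(z in `[s, s]) k z.
  rewrite [in X in _ <= X -> _]set_itv1 Rintegral_set1 subr0 lerBlDr -lerBlDl.
  have -> : \int[mu]_(z in `[s, t]) k z = \int[mu]_(z in `[s, t]) (2 * (h z * x z))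
     + e * (2 * \int[mu]_(z in `[s, t]) `|h z|).
    rewrite RintegralD//; last first.
      by apply: loc_integrableZ; exact: loc_integrable_norm.
    rewrite [X in _ + X = _]RintegralZl//; last exact: loc_integrable_norm.
    by rewrite mulrA [e * 2]mulrC.
  by [].
apply: (@locally_nonincreasing_le _
  (fun y => x y ^+ 2 - \int[mu]_(z in `[s, y]) k z)) => // z _.
have [d d0 Hd] := continuous_osc z cx e0.
exists d => // p q sp pq qt zp qz.
rewrite (Rintegral_itvD ik sp pq).
suff : x q ^+ 2 - x p ^+ 2 <= \int[mu]_(w in `[p, q]) k w by lra.
have -> : x q ^+ 2 - x p ^+ 2 = \int[mu]_(w in `[p, q]) ((x p + x q) * h w).
  rewrite RintegralZl//.
  by rewrite -xh// -[LHS]opprB subr_sqr; lra.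
apply: le_Rintegral => //; first exact: loc_integrableZ.
move=> w; rewrite /= in_itv/= => /andP[pw wq].
have w1 : z - d < w by apply: lt_le_trans zp pw.
have w2 : w < z + d by apply: le_lt_trans wq qz.
have p2 : p < z + d by apply: le_lt_trans pw w2.
have q1 : z - d < q by apply: lt_le_trans w1 wq.
rewrite /k -lerBlDl.
have -> : (x p + x q) * h w - 2 * (h w * x w) =
          (x p - x w + (x q - x w)) * h w by lra.
rewrite (le_trans (ler_norm _))// normrM ler_wpM2r//.
rewrite (le_trans (ler_normD _ _))//.
by have := Hd p w zp p2 w1 w2; have := Hd q w q1 qz w1 w2; lra.
Qed.

(** With the integrating factor [E], the function E u minus a multiple of the integral of b is
    nonincreasing up to an arbitrarily small error. The hypothesis on [K] controls [E] in front of
    [b]. *)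
Lemma gronwall_le (u a b : R -> R) (K : R) s t : continuous u ->
  loc_integrable a -> loc_integrable b -> (forall z, 0 <= b z) -> s <= t ->
  (forall z, s <= z <= t -> 0 <= u z) ->
  (forall p q, s <= p -> p <= q -> q <= t ->
     u q - u p <= \int[mu]_(z in `[p, q]) (a z * u z + b z)) ->
  (forall z, s <= z <= t -> expR (\int[mu]_(w in `[z, t]) a w) <= K) ->
  u t <= expR (\int[mu]_(z in `[s, t]) a z) * u s
         + K * \int[mu]_(z in `[s, t]) b z.
Proof.
move=> cu ia ib b0 st u0 uab aK.
pose E y := expR (- \int[mu]_(z in `[s, y]) a z).
(* [C] dominates [E] on all of [[s, t]], and the final division by [E t] turns it back into [K]. *)
pose C := K * E t.
have EC y : s <= y <= t -> E y <= C.
  move=> /andP[sy yt]; rewrite /C /E (Rintegral_itvD ia sy yt) opprD expRD.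
  rewrite [leRHS]mulrCA ler_pMr ?expR_gt0//.
  rewrite expRN -ler_pdivrMr ?invr_gt0 ?expR_gt0// div1r invrK.
  by apply: aK; rewrite sy yt.
have C0 : 0 <= C by apply: le_trans (EC s _); rewrite ?expR_ge0// lexx st.
have ia' := loc_integrable_norm ia.
suff : E t * u t <= u s + C * \int[mu]_(z in `[s, t]) b z.
  rewrite -(ler_pM2l (expR_gt0 (\int[mu]_(z in `[s, t]) a z))) mulrA.
  rewrite /C /E -expRD subrr expR0 mul1r mulrDr; move/le_trans; apply.
  rewrite lerD2l !mulrA [_ * K]mulrC -[K * _ * _]mulrA -expRD subrr expR0 mulr1.
  exact: lexx.
apply: (@ler_mul_eps _ _ _ (C * \int[mu]_(z in `[s, t]) `|a z|)) => e e0.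
(* The extra term covers the replacement of [u z] by [u p] in the integral of [a * u] over a short
   interval. *)
pose k z := b z + e * `|a z|.
have ik : loc_integrable k by apply: loc_integrableD => //; exact: loc_integrableZ.
have k0 z : 0 <= k z by rewrite addr_ge0// mulr_ge0// ltW.
suff : E t * u t - C * \int[mu]_(z in `[s, t]) k z <=
       E s * u s - C * \int[mu]_(z in `[s, s]) k z.
  rewrite [in X in _ <= X -> _]set_itv1 Rintegral_set1 mulr0 subr0.
  rewrite {2}/E set_itv1 Rintegral_set1 oppr0 expR0 mul1r lerBlDr.
  rewrite RintegralD//; last exact: loc_integrableZ.
  by rewrite RintegralZl// mulrDr mulrCA addrA.
apply: (@locally_nonincreasing_le _
  (fun y => E y * u y - C * \int[mu]_(z in `[s, y]) k z)) => // z _.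
have [d d0 Hd] := continuous_osc z cu e0.
exists d => // p q sp pq qt zp qz.
have up : 0 <= u p by apply: u0; rewrite sp (le_trans pq qt).
rewrite (Rintegral_itvD ik sp pq).
suff : E q * u q <= E p * u p + C * \int[mu]_(w in `[p, q]) k w by lra.
set A := \int[mu]_(z in `[p, q]) a z.
have EpE : E p = E q * expR A.
  by rewrite /E (Rintegral_itvD ia sp pq) -expRD opprD subrK.
have uq : u q <= expR A * u p + \int[mu]_(z in `[p, q]) k z.
  (* Freezing [u] at [p] only yields the linear factor 1 + A; since [u p] is nonnegative, it may be
     enlarged to the exponential. *)
  have Ap : (1 + A) * u p <= expR A * u p by rewrite ler_wpM2r// expR_ge1Dx.
  apply: le_trans (lerD Ap (lexx _)).
  rewrite mulrDl mul1r -addrA -lerBlDl (le_trans (uab p q sp pq qt))//.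
  rewrite -RintegralZr//.
  rewrite -RintegralD//.
    apply: le_Rintegral => //.
    + by apply: loc_integrableD => //; exact: loc_integrableM.
    + apply: loc_integrableD => //.
      have := loc_integrableZ (u p) ia; congr loc_integrable.
      by apply/funext => w; rewrite mulrC.
    move=> w; rewrite /= in_itv/= => /andP[pw wq].
    rewrite /k [b w + _]addrC addrA lerD2r -lerBlDl -mulrBr.
    rewrite (le_trans (ler_norm _))// normrM mulrC ler_wpM2r//.
    apply: Hd => //.
    + exact: lt_le_trans zp pw.
    + exact: le_lt_trans wq qz.
    + exact: le_lt_trans pw (le_lt_trans wq qz).
  have := loc_integrableZ (u p) ia p q; congr (mu.-integrable _ _).
  by apply/funext => w /=; rewrite mulrC.
apply: (@le_trans _ _ (E q * (expR A * u p + \int[mu]_(z in `[p, q]) k z))).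
  by rewrite ler_wpM2l// expR_ge0.
rewrite mulrDr mulrA -EpE lerD2l ler_wpM2r ?Rintegral_itv_ge0//.
by apply: EC; rewrite qt (le_trans sp pq).
Qed.

(** The integrand is half the derivative of the exponential on the right. The factor 1/2 becomes the
    contraction constant of the Picard iteration. *)
Lemma Rintegral_expR_le (l : R -> R) s t : loc_integrable l ->
  (forall z, 0 <= l z) -> s <= t ->
  \int[mu]_(z in `[s, t]) (l z * expR (2 * \int[mu]_(w in `[s, z]) l w))
    <= 2^-1 * expR (2 * \int[mu]_(w in `[s, t]) l w).
Proof.
move=> il l0 st.
pose E y := expR (2 * \int[mu]_(w in `[s, y]) l w).
have cE : continuous E.
  move=> y; apply: continuous_comp; last exact: continuous_expR.
  apply: continuousM; first exact: cvg_cst.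
  exact: Rintegral_itv_continuous.
have ilE : loc_integrable (fun z => l z * E z) by exact: loc_integrableM.
apply: (@ler_mul_eps _ _ _ (\int[mu]_(w in `[s, t]) l w)) => e e0.
pose k z := l z * E z - e * l z.
have ik : loc_integrable k by apply: loc_integrableB => //; exact: loc_integrableZ.
suff : \int[mu]_(z in `[s, t]) k z - 2^-1 * E t <=
       \int[mu]_(z in `[s, s]) k z - 2^-1 * E s.
  rewrite [in X in _ <= X -> _]set_itv1 Rintegral_set1 sub0r.
  rewrite RintegralB//; last exact: loc_integrableZ.
  rewrite RintegralZl//.
  rewrite -/(E t).
  have : 0 <= E s by exact: expR_ge0.
  lra.
apply: (@locally_nonincreasing_le _
  (fun y => \int[mu]_(z in `[s, y]) k z - 2^-1 * E y)) => // z _.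
have [d d0 Hd] := continuous_osc z cE e0.
exists d => // p q sp pq qt zp qz.
rewrite (Rintegral_itvD ik sp pq).
have -> : E q = E p * expR (2 * \int[mu]_(w in `[p, q]) l w).
  by rewrite /E (Rintegral_itvD il sp pq) mulrDr expRD.
have L0 := Rintegral_itv_ge0 p q l0.
have : E p * (1 + 2 * \int[mu]_(w in `[p, q]) l w) <=
       E p * expR (2 * \int[mu]_(w in `[p, q]) l w).
  by rewrite ler_wpM2l ?expR_ge0// expR_ge1Dx.
suff : \int[mu]_(z0 in `[p, q]) k z0 <= E p * \int[mu]_(w in `[p, q]) l w by lra.
rewrite -RintegralZl//.
apply: le_Rintegral => //; first exact: loc_integrableZ.
move=> w; rewrite /= in_itv/= => /andP[pw wq].
rewrite /k [e * _]mulrC -mulrBr [E p * _]mulrC ler_wpM2l// lerBlDl -lerBlDr.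
rewrite (le_trans (ler_norm _))//; apply: Hd => //.
- exact: lt_le_trans zp pw.
- exact: le_lt_trans wq qz.
- exact: le_lt_trans pw (le_lt_trans wq qz).
Qed.

End Gronwall.

(** * Euclidean norm *)

Lemma near_fintype (I : finType) (T : Type) (F : set_system T)
    (P : I -> T -> Prop) : Filter F ->
  (forall i, \forall t \near F, P i t) -> \forall t \near F, forall i, P i t.
Proof.
move=> FF H.
suff : forall s : seq I, \forall t \near F, forall i, i \in s -> P i t.
  by move=> /(_ (enum I)); apply: filterS => t Ht i; apply: Ht; rewrite mem_enum.
elim=> [|i s IH]; first by apply: filterE.
apply: filterS2 (H i) IH => t Hi Hs j; rewrite inE => /predU1P[->//|].
exact: Hs.
Qed.

Lemma cvgr_sum (R : realType) (I T : Type) (F : set_system T) (s : seq I)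
    (g : I -> T -> R) (l : I -> R) : Filter F ->
  (forall i, g i t @[t --> F] --> l i) ->
  \sum_(i <- s) g i t @[t --> F] --> \sum_(i <- s) l i.
Proof.
move=> FF H; elim: s => [|i s IH].
  rewrite big_nil; under eq_fun do rewrite big_nil; exact: cvg_cst.
rewrite big_cons; under eq_fun do rewrite big_cons; exact: cvgD.
Qed.

Section Euclidean.
Context {R : realType} {N : nat}.
Implicit Types (x y z : 'rV[R]_N) (k : R).

Lemma edotC x y : edot x y = edot y x.
Proof. by apply: eq_bigr => i _; rewrite mulrC. Qed.

Lemma edotDl x y z : edot (x + y) z = edot x z + edot y z.
Proof. by rewrite -big_split; apply: eq_bigr => i _; rewrite mxE mulrDl. Qed.

Lemma edotZl k x y : edot (k *: x) y = k * edot x y.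
Proof. by rewrite mulr_sumr; apply: eq_bigr => i _; rewrite mxE mulrA. Qed.

Lemma edotNl x y : edot (- x) y = - edot x y.
Proof. by rewrite -scaleN1r edotZl mulN1r. Qed.

Lemma edotBl x y z : edot (x - y) z = edot x z - edot y z.
Proof. by rewrite edotDl edotNl. Qed.

Lemma edotZr k x y : edot x (k *: y) = k * edot x y.
Proof. by rewrite edotC edotZl edotC. Qed.

Lemma edotBr x y z : edot z (x - y) = edot z x - edot z y.
Proof. by rewrite edotC edotBl ![edot _ z]edotC. Qed.

Lemma edot_ge0 x : 0 <= edot x x.
Proof. by apply: sumr_ge0 => i _; rewrite -expr2 sqr_ge0. Qed.

Lemma enorm_ge0 x : 0 <= enorm x.
Proof. exact: sqrtr_ge0. Qed.

Lemma sqr_enorm x : enorm x ^+ 2 = edot x x.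
Proof. by rewrite sqr_sqrtr// edot_ge0. Qed.

Lemma enormZ k x : enorm (k *: x) = `|k| * enorm x.
Proof. by rewrite /enorm edotZl edotZr mulrA -expr2 sqrtrM ?sqr_ge0// sqrtr_sqr. Qed.

Lemma enorm0 : enorm (0 : 'rV[R]_N) = 0.
Proof. by rewrite -(scale0r 0) enormZ normr0 mul0r. Qed.

Lemma normr_coord_le_enorm x i : `|x ord0 i| <= enorm x.
Proof.
rewrite -sqrtr_sqr ler_wsqrtr// /edot (bigD1 i)//= -expr2 lerDl.
by apply: sumr_ge0 => j _; rewrite -expr2 sqr_ge0.
Qed.

Lemma enorm_eq0 x : enorm x = 0 -> x = 0.
Proof.
move=> x0; apply/rowP => i; rewrite mxE; apply/eqP.
by rewrite -normr_le0 -x0 normr_coord_le_enorm.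
Qed.

Lemma enorm_le_sum x : enorm x <= \sum_(i < N) `|x ord0 i|.
Proof.
have s0 : 0 <= \sum_(i < N) `|x ord0 i| by apply: sumr_ge0.
rewrite -(@ler_pXn2r _ 2)// ?nnegrE ?enorm_ge0// sqr_enorm expr2 mulr_suml.
apply: ler_sum => i _; rewrite (le_trans (ler_norm _))// normrM ler_wpM2l//.
by rewrite (bigD1 i)//= lerDl sumr_ge0.
Qed.

Lemma edot_le_enorm x y : edot x y <= enorm x * enorm y.
Proof.
have [x0|x0] := eqVneq (enorm x) 0.
  by rewrite x0 mul0r (enorm_eq0 x0) -(scale0r 0) edotZl mul0r.
have [y0|y0] := eqVneq (enorm y) 0.
  by rewrite y0 mulr0 (enorm_eq0 y0) -(scale0r 0) edotZr mul0r.
have p : 0 < enorm x * enorm y by rewrite mulr_gt0// lt_neqAle eq_sym ?x0 ?y0 enorm_ge0.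
(* Cauchy-Schwarz: expanding this square gives the inequality multiplied by [enorm x * enorm y],
   which is positive here. *)
have := edot_ge0 (enorm y *: x - enorm x *: y).
rewrite edotBl !edotBr !edotZl !edotZr -!sqr_enorm [edot y x]edotC => H.
rewrite -(ler_pM2l p); move: H.
set X := enorm x; set Y := enorm y; set e := edot x y.
nra.
Qed.

Lemma continuous_enorm : continuous (@enorm R N).
Proof.
move=> x; apply: continuous_comp; last exact: sqrt_continuous.
apply: (@cvgr_sum _ _ _ (nbhs x) _ (fun i (y : 'rV[R]_N) => y ord0 i * y ord0 i)) => i.
by apply: cvgM; exact: coord_continuous.
Qed.

Lemma closed_eball k : closed [set x : 'rV[R]_N | enorm x <= k].
Proof.
apply: (@closed_comp _ _ (@enorm R N) [set r | r <= k]) => [x _|].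
  exact: continuous_enorm.
exact: closed_le.
Qed.

Lemma compact_eball k : compact [set x : 'rV[R]_N | enorm x <= k].
Proof.
apply: bounded_closed_compact; last exact: closed_eball.
exists k; split => [|M kM x /= xk]; first exact: num_real.
rewrite [leLHS]/Num.Def.normr/= mx_normrE; apply/bigmax_leP; split => [|[i j] _ /=].
  by rewrite (le_trans (enorm_ge0 x))// (le_trans xk) ?ltW.
rewrite ord1 (le_trans (normr_coord_le_enorm _ _))// (le_trans xk)// ltW//.
Qed.

Lemma nbhs_coordP x (A : set 'rV[R]_N) : nbhs x A ->
  exists2 e : R, 0 < e &
    forall y, (forall i, `|x ord0 i - y ord0 i| < e) -> A y.
Proof.
move=> /nbhs_ballP[e /= e0 H]; exists e => // y Hy; apply: H.
by split => // i j; rewrite ord1; exact: Hy.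
Qed.

Lemma cvg_coord (T : Type) (F : set_system T) (g : T -> 'rV[R]_N) x :
  Filter F -> (forall i, g t ord0 i @[t --> F] --> x ord0 i) ->
  g @ F --> x.
Proof.
move=> FF H; apply/cvg_ballP => e e0.
have : \forall t \near F, forall i, `|x ord0 i - g t ord0 i| < e.
  apply: near_fintype => i; have /cvgrPdist_lt := H i; exact.
by apply: filterS => t Ht; split => // i j; rewrite ord1; exact: Ht.
Qed.

Lemma enorm_near0 x (A : set 'rV[R]_N) : nbhs x A ->
  exists2 e : R, 0 < e & forall y, enorm (x - y) < e -> A y.
Proof.
move=> /nbhs_coordP[e e0 H]; exists e => // y xy; apply: H => i.
apply: le_lt_trans xy.
by have := normr_coord_le_enorm (x - y) i; rewrite !mxE.
Qed.

End Euclidean.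

(** * Sections of null sets *)

Lemma measurable_borel_comp (R : realType) (N : nat)
    (f : R -> 'rV[R]_N -> 'rV[R]_N) (y : R -> 'rV[R]_N) (i : 'I_N) :
  borel_fun f -> continuous y ->
  measurable_fun setT (fun s => f s (y s) ord0 i).
Proof.
move=> bf cy.
pose p (s : R) : (R * 'rV[R]_N)%type := (s, y s).
have cp : continuous p.
  move=> s A [[P Q] /= [nP nQ] PQ].
  by apply: filterS (filterI nP (cy s _ nQ)) => z [Pz Qz]; exact: (PQ (z, y z)).
(* The sets with measurable preimage under the continuous graph map [p] form a sigma-algebra
   containing the open sets, hence all the Borel sets of the product. *)
pose H : set (set (R * 'rV[R]_N)%type) :=
  [set A | measurable (p @^-1` A : set (measurableTypeR R))].
have sH : <<s [set A : set (R * 'rV[R]_N)%type | open A] >> `<=` H.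
  apply: smallest_sub.
    split => [|A HA|F HF]; rewrite /H/=.
    - by rewrite preimage_set0; exact: measurable0.
    - by rewrite setTD preimage_setC; exact: measurableC.
    - by rewrite preimage_bigcup; apply: bigcup_measurable => k _; exact: HF.
  move=> A /= oA; apply: open_measurable.
  by apply: open_comp => // x _; exact: cp.
apply: (measurability _ (RGenOInfty.measurableE R)) => // _ [_ [x ->] <-].
rewrite setTI.
have oU : open [set v : 'rV[R]_N | x < v ord0 i].
  apply: (@open_comp _ _ (fun v : 'rV[R]_N => v ord0 i) [set r | x < r]).
    by move=> v _; exact: coord_continuous.
  exact: open_gt.
have := sH _ (bf _ oU); rewrite /H/=.
by congr measurable; apply/seteqP; split => s /=; rewrite in_itv/= andbT.
Qed.

Section NullSections.
Context {R : realType}.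
Local Notation mu := (@lebesgue_measure R).

Lemma mem_itv_cc (l u x : R) : (x \in `[l, u]%classic) = (l <= x <= u).
Proof. by apply/idP/idP; rewrite inE /= in_itv. Qed.

Lemma integral_indic_itv_le (c l u : R) (D : set (measurableTypeR R)) : measurable D ->
  0 <= c -> l <= u ->
  (\int[mu]_(x in D) ((l <= (x : R) <= u)%R%:R * c)%:E <= ((u - l) * c)%:E)%E.
Proof.
move=> mD c0 lu.
have E (x : R) : ((l <= x <= u)%R%:R * c)%:E = (c%:E * (\1_(`[l, u]%classic) x)%:E)%E.
  by rewrite -EFinM mulrC indicE mem_itv_cc.
under eq_integral do rewrite E.
rewrite ge0_integralZl//; last exact/measurable_EFinP/measurable_indic.
rewrite integral_indic// mulrC EFinM lee_wpmul2l//.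
apply: (@le_trans _ _ (mu `[l, u]%classic)).
  by apply: le_measure => //; rewrite inE//; exact: measurableI.
rewrite lebesgue_measure_itv/= lte_fin -EFinB; case: ifPn => //.
by rewrite lee_fin subr_ge0 lu.
Qed.

Lemma measurable_indic_itvM (c l u : R) (D : set (measurableTypeR R)) :
  measurable_fun D (fun x => ((l <= x <= u)%R%:R * c)%:E : \bar R).
Proof.
apply/measurable_EFinP; apply: measurable_funM => //.
have -> : (fun x : R => (l <= x <= u)%R%:R : R) = \1_(`[l, u]%classic).
  by apply/funext => x; rewrite indicE mem_itv_cc.
exact: measurable_indic.
Qed.

(* Slicing along the first coordinate and integrating the slices in dimension
   one reduces the dimension; the boolean mask c records which boxes meet the
   current slice. *)
Lemma box_vol_subadditive N (p q : 'I_N -> R) (l u : nat -> 'I_N -> R)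
    (c : nat -> bool) :
  (forall i, p i <= q i) -> (forall n i, l n i <= u n i) ->
  (forall x : 'I_N -> R, (forall i, p i <= x i <= q i) ->
     exists n, c n /\ forall i, l n i <= x i <= u n i) ->
  ((\prod_(i < N) (q i - p i))%:E <=
     \sum_(n <oo) ((c n)%:R * \prod_(i < N) (u n i - l n i))%:E)%E.
Proof.
elim: N p q l u c => [|N IH] p q l u c pq lu cov.
  (* In dimension zero a box is one point of volume 1, and the covering supplies an active index [n]
     whose term alone is 1. *)
  have [|n [cn _]] := cov (fun=> 0); first by case.
  rewrite big_ord0.
  apply: le_trans (nneseries_lim_ge n.+1 _); last first.
    by move=> k _ _; rewrite lee_fin mulr_ge0// big_ord0.
  rewrite big_nat_recr//= cn big_ord0 mul1r -[leLHS]add0e leeD2r//.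
  by apply: sume_ge0 => k _; rewrite lee_fin big_ord0 mulr1.
pose V n := \prod_(i < N) (u n (lift ord0 i) - l n (lift ord0 i)).
have V0 n : 0 <= V n by apply: prodr_ge0 => i _; rewrite subr_ge0.
pose g n (t : R) := ((l n ord0 <= t <= u n ord0)%R%:R * ((c n)%:R * V n))%:E : \bar R.
have slice (t : R) : p ord0 <= t <= q ord0 ->
    ((\prod_(i < N) (q (lift ord0 i) - p (lift ord0 i)))%:E <=
     \sum_(n <oo) g n t)%E.
  move=> tpq.
  have := IH (fun i => p (lift ord0 i)) (fun i => q (lift ord0 i))
    (fun n i => l n (lift ord0 i)) (fun n i => u n (lift ord0 i))
    (fun n => c n && (l n ord0 <= t <= u n ord0)).
  move=> /(_ (fun i => pq _) (fun n i => lu _ _)) IHt.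
  apply: le_trans (IHt _) _.
    move=> x xpq.
    have [|n [cn Hn]] := cov (fun i => if unlift ord0 i is Some j then x j else t).
      by move=> i; case: unliftP => [j ->|->].
    exists n; have := Hn ord0; rewrite unlift_none cn => ->; split => // i.
    by have := Hn (lift ord0 i); rewrite liftK.
  apply: lee_nneseries => [n _ _|n _]; first by rewrite lee_fin mulr_ge0//; exact: V0.
  by rewrite /g lee_fin mulrA -natrM mulnb andbC.
rewrite big_ord_recl/= mulrC.
have -> : ((\prod_(i < N) (q (lift ord0 i) - p (lift ord0 i)) *
   (q ord0 - p ord0))%:E = \int[mu]_(t in `[p ord0, q ord0])
     cst ((\prod_(i < N) (q (lift ord0 i) - p (lift ord0 i)))%:E) t)%E.
  rewrite integral_cst//= lebesgue_measure_itv/= lte_fin EFinM -EFinB.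
  have := pq ord0; rewrite le_eqVlt => /predU1P[->|->//].
  by rewrite ltxx subrr.
have g0 n t : (0 <= g n t)%E by rewrite lee_fin mulr_ge0//; exact: mulr_ge0.
apply: (@le_trans _ _ (\int[mu]_(t in `[p ord0, q ord0]) (\sum_(n <oo) g n t))%E).
  apply: ge0_le_integral => //.
  - by move=> t _; rewrite lee_fin prodr_ge0// => i _; rewrite subr_ge0.
  - apply: ge0_emeasurable_sum => // n _ _.
    exact: measurable_indic_itvM.
rewrite integral_nneseries//; last by move=> n; exact: measurable_indic_itvM.
apply: lee_nneseries => [n _ _|n _]; first exact: integral_ge0.
apply: le_trans (integral_indic_itv_le _ _ _) _ => //; first exact: mulr_ge0.
by rewrite lee_fin big_ord_recl mulrCA.
Qed.

(** Cover [E] by boxes of total volume at most 1/(k+1) and let [G k t] be the total volume of their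
    slices at time [t]. If the slice of [E] contains the whole box then [G k t >= v], while the
    integral of [G k] is at most 1/(k+1); a Markov estimate makes such times a null set. *)
Lemma null_set_section_box N (E : set (R * 'rV[R]_N)%type) (p q : 'rV[R]_N) :
  null_set_R1N E -> (forall i, p ord0 i < q ord0 i) ->
  {ae mu, forall t, exists x : 'rV[R]_N, (forall i, p ord0 i <= x ord0 i <= q ord0 i) /\
                              ~ E (t, x)}.
Proof.
move=> E0 pq; pose v := \prod_(i < N) (q ord0 i - p ord0 i).
have v0 : 0 < v by apply: prodr_gt0 => i _; rewrite subr_gt0.
pose P (k : nat) (G : R -> \bar R) := [/\ measurable_fun setT G,
    (forall t, 0 <= G t)%E, (\int[mu]_t G t <= (k.+1%:R^-1)%:E)%E &
    forall t, (forall x : 'rV[R]_N, (forall i, p ord0 i <= x ord0 i <= q ord0 i) ->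
      E (t, x)) -> (v%:E <= G t)%E].
have HP k : exists G, P k G.
  have [|a [b [l [u [ablu [cov vol]]]]]] := E0 k.+1%:R^-1; first by rewrite invr_gt0.
  pose V n := \prod_(i < N) (u n ord0 i - l n ord0 i).
  have V0 n : 0 <= V n.
    by apply: prodr_ge0 => i _; rewrite subr_ge0; case: (ablu n).
  pose g n (t : R) := ((a n <= t <= b n)%R%:R * V n)%:E : \bar R.
  have g0 n t : (0 <= g n t)%E by rewrite lee_fin mulr_ge0.
  exists (fun t => \sum_(n <oo) g n t)%E; split.
  - by apply: ge0_emeasurable_sum => // n _ _; exact: measurable_indic_itvM.
  - by move=> t; apply: nneseries_ge0.
  - rewrite integral_nneseries//; last by move=> n; exact: measurable_indic_itvM.
    apply: lime_le; first by apply: is_cvg_nneseries => n _ _; exact: integral_ge0.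
    apply: nearW => n; apply: (@le_trans _ _
        (\sum_(0 <= j < n) (box_vol (a j) (b j) (l j) (u j))%:E)%E).
      apply: lee_sum => j _; apply: le_trans (integral_indic_itv_le _ _ _) _ => //.
      by case: (ablu j).
    by rewrite big_mkord sumEFin lee_fin.
  - move=> t Et.
    apply: (@box_vol_subadditive _ (p ord0) (q ord0) (fun n => l n ord0)
      (fun n => u n ord0) (fun n => a n <= t <= b n)).
    + by move=> i; exact: ltW.
    + by move=> n i; case: (ablu n).
    move=> x xpq; have [|n _ [tn xn]] := cov (t, \row_i x i).
      by apply: Et => i; rewrite mxE.
    by exists n; split => // i; have := xn i; rewrite /= mxE.
have [G HG] := choice HP.
(* A measurable set containing all bad times; its measure times [v] is at most 1/(k+1) for every
   [k]. *)
pose Z : set (measurableTypeR R) := \bigcap_k [set t | v%:E <= G k t]%E.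
have mZk k : measurable ([set t | v%:E <= G k t]%E : set (measurableTypeR R)).
  have [mG _ _ _] := HG k; rewrite -[X in measurable X]setTI.
  exact: emeasurable_fun_c_infty.
have mZ : measurable Z by exact: bigcap_measurable.
exists Z; split => //; last first.
  move=> t /= Ht k _; have [_ _ _] := HG k; apply => x xpq.
  by apply: contrapT => nE; apply: Ht; exists x.
have vZ k : (v%:E * mu Z <= (k.+1%:R^-1)%:E)%E.
  have [mG G0 iG _] := HG k; apply: le_trans iG.
  rewrite -integral_cst//.
  apply: (@le_trans _ _ (\int[mu]_(t in Z) G k t)%E).
    apply: ge0_le_integral => //.
    - by move=> t _; rewrite /= lee_fin ltW.
    - exact: measurable_funTS.
    - by move=> t; exact.
  by apply: ge0_subset_integral.
have vZ0 : (v%:E * mu Z <= 0)%E.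
  apply/lee_addgt0Pr => e e0; rewrite add0e.
  have [k ke] : exists k, k.+1%:R^-1 < e.
    by have [k _ H] := near_infty_natSinv_lt (PosNum e0); exists k; apply: H => /=.
  by apply: le_trans (vZ k) _; rewrite lee_fin ltW.
apply/eqP; rewrite eq_le measure_ge0 andbT.
by move: vZ0; rewrite pmule_rle0// lte_fin.
Qed.

End NullSections.

(** * From almost every (t, x) to almost every t and all x *)

Section EverywhereBounds.
Context {R : realType} {N : nat}.
Local Notation mu := (@lebesgue_measure R).
Variable f : R -> 'rV[R]_N -> 'rV[R]_N.

Lemma LC_eball (M : R) : LC f ->
  exists m l : R -> R, [/\ loc_integrable m, loc_integrable l &
    {ae mu, forall t, forall x y, enorm x <= M -> enorm y <= M ->
      enorm (f t x) <= m t /\ enorm (f t x - f t y) <= l t * enorm (x - y)}].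
Proof.
by move=> [_ /(_ _ (@compact_eball R N M))[m [l [im [il H]]]]]; exists m, l; split.
Qed.

(** Balls of integer radius give countably many exceptional null sets, hence a single one. At any
    other time [f t] is Lipschitz on a ball containing a neighbourhood of the given point. *)
Lemma LC_continuous : LC f -> {ae mu, forall t, continuous (f t)}.
Proof.
move=> fLC; have [l Hl] := choice (fun n : nat => LC_eball n%:R fLC).
have {Hl}Hl (n : nat) : exists l : R -> R, {ae mu, forall t,
    forall x y, enorm x <= n%:R -> enorm y <= n%:R ->
      enorm (f t x - f t y) <= l t * enorm (x - y)}.
  have [k [_ _ H]] := Hl n; exists k; apply: ae_leb_imp H => t H x y xn yn.
  by have [] := H x y xn yn.
have {l}[l /ae_foralln {}Hl] := choice Hl.
apply: ae_leb_imp Hl => t Ht x.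
pose n := (Num.trunc (enorm x)).+1.
have xn : enorm x < n%:R by exact: truncnS_gt.
apply: (@cvg_coord _ _ _ (nbhs x)) => i; apply/cvgrPdist_lt => e e0.
have ce : enorm (x - y) @[y --> x] --> enorm (x - x).
  have cs : (fun y : 'rV[R]_N => x - y) @ x --> x - x.
    apply: (@cvg_coord _ _ _ (nbhs x)) => i'; rewrite !mxE.
    under eq_fun do rewrite !mxE.
    by apply: cvgB; [exact: cvg_cst|exact: coord_continuous].
  exact: (cvg_comp _ _ cs (@continuous_enorm R N (x - x))).
have c0 : l n t * enorm (x - y) @[y --> x] --> l n t * enorm (x - x).
  by apply: cvgM ce; exact: cvg_cst.
rewrite subrr enorm0 mulr0 in c0.
have yn : \forall y \near x, enorm y < n%:R.
  exact: (@continuous_enorm R N x _ (lt_nbhsl xn)).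
have /cvgrPdist_lt /(_ _ e0) c1 := c0.
apply: filterS2 yn c1 => y yn; rewrite sub0r normrN => c1.
apply: le_lt_trans (le_lt_trans (ler_norm _) c1).
apply: le_trans (Ht n x y (ltW xn) (ltW yn)).
by have := normr_coord_le_enorm (f t x - f t y) i; rewrite !mxE.
Qed.

(** Density can be tested on boxes with rational corners. These are enumerated through [unpickle],
    so their exceptional times form one null set. *)
Lemma null_set_section_dense (E : set (R * 'rV[R]_N)%type) : null_set_R1N E ->
  {ae mu, forall t, forall (x : 'rV[R]_N) (A : set 'rV[R]_N), nbhs x A ->
     exists2 y, A y & ~ E (t, y)}.
Proof.
move=> E0.
pose P (k : nat) (t : R) := forall p q : 'rV[rat]_N, unpickle k = Some (p, q) ->
  (forall i, p ord0 i < q ord0 i) ->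
  exists x : 'rV[R]_N, (forall i, ratr (p ord0 i) <= x ord0 i <= ratr (q ord0 i))
    /\ ~ E (t, x).
have HP k : {ae mu, forall t, P k t}.
  rewrite /P; case: unpickle => [[p q]|]; last exact: aeW.
  have [pq|npq] := pselect (forall i, p ord0 i < q ord0 i); last first.
    by apply: aeW => t p' q' [<- <-].
  have := @null_set_section_box R N E (map_mx ratr p) (map_mx ratr q) E0.
  have pq' i : map_mx (ratr : rat -> R) p ord0 i < map_mx ratr q ord0 i.
    by rewrite !mxE ltr_rat.
  move=> /(_ pq'); apply: ae_leb_imp => t [x [xpq nE]] p' q' [<- <-] _.
  by exists x; split => // i; have := xpq i; rewrite !mxE.
apply: ae_leb_imp (ae_foralln HP) => t Ht x A /nbhs_coordP[e e0 xA].
have Hp i : exists r, ratr r \in `]x ord0 i - e, x ord0 i[.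
  by apply: rat_in_itvoo; rewrite ltrBlDr ltrDl.
have Hq i : exists r, ratr r \in `]x ord0 i, x ord0 i + e[.
  by apply: rat_in_itvoo; rewrite ltrDl.
have {Hp}[p Hp] := choice Hp; have {Hq}[q Hq] := choice Hq.
have [|i|y [Hy nE]] := Ht (pickle (\row_i p i, \row_i q i)) (\row_i p i) (\row_i q i).
- exact: pickleK.
- rewrite !mxE -(@ltr_rat R).
  by have := Hp i; have := Hq i; rewrite !in_itv/= => /andP[q1 _] /andP[_ p1]; exact: lt_trans q1.
exists y => //; apply: xA => i.
have := Hp i; have := Hq i; have := Hy i; rewrite !mxE !in_itv/= ltr_distl.
by move=> /andP[h1 h2] /andP[h3 h4] /andP[h5 h6]; apply/andP; split; lra.
Qed.

Lemma H1_everywhere (a b : R -> R) : LC f -> H1 f a b ->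
  {ae mu, forall t, forall x, 2 * edot (f t x) x <= a t * enorm x ^+ 2 + b t}.
Proof.
move=> fLC [_ [_ [_ /null_set_section_dense E0]]].
apply: ae_leb_imp (ae_leb_and (LC_continuous fLC) E0) => t [ct dt] x.
rewrite leNgt; apply/negP => xlt.
(* A strict failure at [x] is the condition [b t < F x], which persists near [x] by continuity of
   [F] and so reaches a point where the inequality is known. *)
pose F y := 2 * edot (f t y) y - a t * enorm y ^+ 2.
have cF : F y @[y --> x] --> F x.
  apply: (cvgB (F := nbhs x)); (apply: (cvgM (F := nbhs x)); first exact: cvg_cst).
    apply: (@cvgr_sum _ _ _ (nbhs x) _
      (fun i (y : 'rV[R]_N) => f t y ord0 i * y ord0 i)) => i.
    apply: (cvgM (F := nbhs x)); last exact: coord_continuous.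
    by apply: (@continuous_comp _ _ _ (f t) (fun y : 'rV[R]_N => y ord0 i));
      [exact: ct|exact: coord_continuous].
  by apply: (cvgM (F := nbhs x)); exact: continuous_enorm.
have bF : b t < F x by rewrite /F ltrBrDl.
have [y /= yb nE] := dt x _ (cF _ (lt_nbhsr bF)).
apply: nE => /=; apply/negP; rewrite -ltNge.
by move: yb; rewrite /= /F ltrBrDl.
Qed.

End EverywhereBounds.

(** * Energy estimates *)

Section Primitives.
Context {R : realType} {N : nat}.
Local Notation mu := (@lebesgue_measure R).
Implicit Types (v w x y : R -> 'rV[R]_N) (r s t : R).

(** [v] stands for the derivative of [x]. The integral vanishes for t < r, so [x] is constant there
    and continuous on the whole line, which lets the lemmas on global functions apply. *)
Definition primitive r v x := forall i : 'I_N,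
  loc_integrable (fun z => v z ord0 i) /\
  forall t, x t ord0 i = x r ord0 i + \int[mu]_(z in `[r, t]) v z ord0 i.

Lemma primitive_continuous r v x i : primitive r v x ->
  continuous (fun t => x t ord0 i).
Proof.
move=> /(_ i)[iv xE] t.
have -> : (fun t => x t ord0 i) =
    (fun t => x r ord0 i + \int[mu]_(z in `[r, t]) v z ord0 i) by exact/funext.
by apply: cvgD; [exact: cvg_cst|exact: Rintegral_itv_continuous].
Qed.

Lemma primitive_sub r v x i s t : primitive r v x -> r <= s -> s <= t ->
  x t ord0 i - x s ord0 i = \int[mu]_(z in `[s, t]) v z ord0 i.
Proof.
move=> /(_ i)[iv xE] rs st; rewrite xE (xE s) (Rintegral_itvD iv rs st); lra.
Qed.

Lemma primitiveB r v x w y : primitive r v x -> primitive r w y ->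
  primitive r (fun z => v z - w z) (fun z => x z - y z).
Proof.
move=> px py i; have [iv xE] := px i; have [iw yE] := py i.
have E : (fun z => (v z - w z) ord0 i) = (fun z => v z ord0 i - w z ord0 i).
  by apply/funext => z; rewrite !mxE.
rewrite E; split => [|t]; first exact: loc_integrableB.
by rewrite RintegralB// !mxE xE yE; lra.
Qed.

Lemma primitive_sqr_enorm_le r v x s t : primitive r v x -> r <= s -> s <= t ->
  enorm (x t) ^+ 2 - enorm (x s) ^+ 2 <=
  \int[mu]_(z in `[s, t]) (2 * edot (v z) (x z)).
Proof.
move=> px rs st; rewrite !sqr_enorm /edot -sumrB.
have ic i : loc_integrable (fun z => 2 * (v z ord0 i * x z ord0 i)).
  apply: loc_integrableZ; apply: loc_integrableM; first by case: (px i).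
  exact: primitive_continuous px.
have -> : \int[mu]_(z in `[s, t]) (2 * \sum_(i < N) v z ord0 i * x z ord0 i) =
    \sum_(i < N) \int[mu]_(z in `[s, t]) (2 * (v z ord0 i * x z ord0 i)).
  elim: (index_enum _) => [|i l IH].
    under eq_Rintegral do rewrite big_nil mulr0.
    by rewrite big_nil Rintegral_cst// mul0r.
  rewrite big_cons -IH -RintegralD//.
    by under eq_Rintegral do rewrite big_cons mulrDr.
    exact: ic.
  have := loc_integrable_sum l ic s t; congr (mu.-integrable _ _).
  by apply/funext => z /=; rewrite mulr_sumr.
apply: ler_sum => i _; rewrite -!expr2.
apply: (@primitive_sqr_le _ (fun z => x z ord0 i)) => //.
- exact: primitive_continuous px.
- by case: (px i).
- by move=> p q sp pq _; apply: primitive_sub => //; exact: le_trans sp.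
Qed.

Lemma primitive_enorm_continuous r v x : primitive r v x ->
  continuous (fun z => enorm (x z)).
Proof.
move=> px z; apply: (@cvg_comp _ _ _ x (@enorm R N)); last exact: continuous_enorm.
apply: (@cvg_coord _ _ _ (nbhs z)) => i; exact: primitive_continuous px z.
Qed.

(** Gronwall for the squared norm. It serves three times: for the difference of two solutions, for
    the retracted equation, and for the dissipative estimate itself. *)
Lemma primitive_energy_le r v x (a b : R -> R) (K : R) s t :
  primitive r v x -> r <= s -> s <= t ->
  loc_integrable a -> loc_integrable b -> (forall z, 0 <= b z) ->
  {ae mu, forall z, s <= z <= t ->
     2 * edot (v z) (x z) <= a z * enorm (x z) ^+ 2 + b z} ->
  (forall z, s <= z <= t -> expR (\int[mu]_(w in `[z, t]) a w) <= K) ->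
  enorm (x t) ^+ 2 <= expR (\int[mu]_(z in `[s, t]) a z) * enorm (x s) ^+ 2
         + K * \int[mu]_(z in `[s, t]) b z.
Proof.
move=> px rs st ia ib b0 H aK.
have cu : continuous (fun z => enorm (x z) ^+ 2).
  by move=> z; apply: cvgM; exact: primitive_enorm_continuous px z.
apply: (@gronwall_le _ (fun z => enorm (x z) ^+ 2)) => //.
  by move=> z _; exact: sqr_ge0.
move=> p q sp pq qt.
apply: le_trans (primitive_sqr_enorm_le px (le_trans rs sp) pq) _.
apply: le_Rintegral_ae.
- apply: loc_integrableZ; apply: loc_integrable_sum => i.
  apply: loc_integrableM; first by case: (px i).
  exact: primitive_continuous px.
- by apply: loc_integrableD => //; exact: loc_integrableM.
- apply: ae_leb_imp H => z H /andP[pz zq]; apply: H.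
  by rewrite (le_trans sp pz) (le_trans zq qt).
Qed.

(** A solution lives on a half-line only: [v] is continued by 0 and the solution by its initial
    value to the left of [r]. *)
Lemma solution_primitive (f : R -> 'rV[R]_N -> 'rV[R]_N) r (x0 : 'rV[R]_N) x :
  is_solution f r x0 x -> exists v y, [/\ primitive r v y, y r = x0 &
    forall z, r <= z -> y z = x z /\ v z = f z (x z)].
Proof.
move=> [xr xE]; pose v z := if r <= z then f z (x z) else 0.
have iv i : loc_integrable (fun z => v z ord0 i).
  move=> p q.
  have -> : EFin \o (fun z => v z ord0 i) =
     (EFin \o (fun z => f z (x z) ord0 i)) \_ [set z | r <= z].
    apply/funext => z /=; rewrite patchE /v.
    by have [rz|rz] := boolP (r <= z); [rewrite mem_set|rewrite memNset ?mxE//; apply/negP].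
  have mr : measurable ([set z | r <= z] : set (measurableTypeR R)).
    rewrite (_ : [set z | r <= z] = `[r, +oo[%classic)//.
    by apply/seteqP; split => z /=; rewrite in_itv/= andbT.
  apply/integrable_restrict => //.
  have [|iq _] := xE (Num.max r q) _ i; first by rewrite le_max lexx.
  apply: integrableS iq => //; first exact: measurableI.
  move=> z [/=]; rewrite !in_itv/= => /andP[_ zq] rz.
  by rewrite rz le_max zq orbT.
exists v, (fun z => x (Num.max r z)); split; last 2 first.
- by rewrite maxxx.
- by move=> z rz; rewrite /v rz max_r.
move=> i; split => // t; rewrite maxxx xr.
have [|_ ->] := xE (Num.max r t) _ i; first by rewrite le_max lexx.
rewrite [in RHS]Rintegral_itv_max; congr (_ + _).
apply: eq_Rintegral => z; rewrite inE /= in_itv/= /v => /andP[-> _].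
by [].
Qed.

(** The energy estimate for x - y with rate 2|l| and no source term. As [C] is chosen before the
    solutions, both uniqueness and continuous dependence follow. *)
Lemma LC_solutions_dist (f : R -> 'rV[R]_N -> 'rV[R]_N) (M r t : R) :
  LC f -> r <= t -> exists2 C, 0 <= C & forall v x w y,
    primitive r v x -> primitive r w y ->
    (forall z, r <= z <= t -> v z = f z (x z) /\ w z = f z (y z)) ->
    (forall z, r <= z <= t -> enorm (x z) <= M /\ enorm (y z) <= M) ->
    enorm (x t - y t) ^+ 2 <= C * enorm (x r - y r) ^+ 2.
Proof.
move=> fLC rt; have [m [l [_ il H]]] := LC_eball M fLC.
pose a z := 2 * `|l z|.
have ia : loc_integrable a by apply: loc_integrableZ; exact: loc_integrable_norm.
have a0 z : 0 <= a z by rewrite mulr_ge0.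
exists (expR (\int[mu]_(z in `[r, t]) a z)); first exact: expR_ge0.
move=> v x w y px py vw xyM.
have := @primitive_energy_le r _ _ a (fun=> 0) (expR (\int[mu]_(z in `[r, t]) a z))
  r t (primitiveB px py) (lexx r) rt ia (loc_integrable_cst 0) (fun=> lexx 0).
rewrite Rintegral_cst// mul0r mulr0 addr0; apply.
  apply: ae_leb_imp H => z Hz rzt; rewrite addr0.
  have [-> ->] := vw z rzt; have [xM yM] := xyM z rzt.
  have [_ lz] := Hz _ _ xM yM.
  apply: (@le_trans _ _ (2 * (enorm (f z (x z) - f z (y z)) * enorm (x z - y z)))).
    by rewrite ler_pM2l// edot_le_enorm.
  rewrite /a -mulrA ler_pM2l// expr2 mulrA ler_wpM2r ?enorm_ge0//.
  by rewrite (le_trans lz)// ler_wpM2r ?enorm_ge0// ler_norm.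
move=> z /andP[rz zt]; rewrite ler_expR (Rintegral_itvD ia rz zt) lerDr.
exact: Rintegral_itv_ge0.
Qed.

End Primitives.

(** * Picard iteration *)

Section Geometric.
Context {R : realType}.
Local Notation h := (2^-1 : R).

Lemma dist3_le (x y x' y' e : R) : `|y - y'| <= e / 3 -> `|x - x'| <= e / 3 ->
  `|x' - y'| <= e / 3 -> `|x - y| <= e.
Proof.
rewrite !ler_norml => /andP[a1 a2] /andP[b1 b2] /andP[d1 d2].
by apply/andP; split; lra.
Qed.

Lemma half_expn_ge0 n : 0 <= h ^+ n.
Proof. by rewrite exprn_ge0// invr_ge0. Qed.

Lemma half_expnS n : h ^+ n = h ^+ n.+1 + h ^+ n.+1.
Proof. rewrite exprS; lra. Qed.

Lemma half_expn_small (c e : R) : 0 < e -> exists n, c * h ^+ n < e.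
Proof.
move=> e0.
have c0 : c * h ^+ n @[n --> \oo] --> c * 0.
  apply: cvgM; first exact: cvg_cst.
  apply: cvg_expr; rewrite ger0_norm ?invr_ge0// invf_lt1// ltr1n//.
rewrite mulr0 in c0; have /cvgrPdist_lt /(_ _ e0)[n _ H] := c0.
exists n; have := H n (leqnn n); rewrite /= sub0r normrN.
exact: le_lt_trans (ler_norm _).
Qed.

Lemma le_half_expn (a c : R) : (forall n, a <= c * h ^+ n) -> a <= 0.
Proof.
move=> H; apply/ler_addgt0Pr => e e0; rewrite add0r.
by have [n ne] := half_expn_small c e0; exact: le_trans (H n) (ltW ne).
Qed.

Lemma half_expn_bound (w w' e : R) n : 2 * w' * h ^+ n < e -> w <= w' ->
  2 * h ^+ n * w <= e.
Proof.
move=> /ltW we ww; apply: le_trans we; rewrite mulrAC.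
by rewrite ler_wpM2r ?half_expn_ge0// ler_pM2l.
Qed.

(** The intervals of radius 2 c h^n around [u n] are nested, since the tails of the geometric series
    sum to that radius; the limit is the supremum of their left ends. *)
Lemma geometric_limit (u : nat -> R) (c : R) : 0 <= c ->
  (forall n, `|u n.+1 - u n| <= c * h ^+ n) ->
  exists l, forall n, `|l - u n| <= 2 * c * h ^+ n.
Proof.
move=> c0 H; pose w n := u n - 2 * c * h ^+ n; pose v n := u n + 2 * c * h ^+ n.
have H2 n : - (c * h ^+ n) <= u n.+1 - u n <= c * h ^+ n by rewrite -ler_norml.
have wS n : w n <= w n.+1.
  by have := H2 n; rewrite /w (half_expnS n) => /andP[]; lra.
have vS n : v n.+1 <= v n.
  by have := H2 n; rewrite /v (half_expnS n) => /andP[]; lra.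
have wv n : w n <= v n by rewrite /w /v; have := mulr_ge0 c0 (half_expn_ge0 n); lra.
have wm : {homo w : m n / (m <= n)%N >-> m <= n} by exact/nondecreasing_seqP.
have vm m n : (m <= n)%N -> v n <= v m.
  by move: m n; apply/nonincreasing_seqP.
have ub m : ubound (range w) (v m).
  move=> _ [n _ <-]; have [mn|/ltnW nm] := leqP m n.
    exact: le_trans (wv n) (vm _ _ mn).
  exact: le_trans (wm _ _ nm) (wv m).
exists (sup (range w)) => n.
have l1 : w n <= sup (range w) by apply: ub_le_sup; [exists (v 0%N); exact: ub|exists n].
have l2 : sup (range w) <= v n by apply: ge_sup; [exists (w 0%N); exists 0%N|exact: ub].
by rewrite ler_norml; move: l1 l2; rewrite /w /v => l1 l2; apply/andP; split; lra.
Qed.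

End Geometric.

(** * Picard iteration in a weighted norm *)

Section Picard.
Context {R : realType} {N : nat}.
Local Notation mu := (@lebesgue_measure R).
Local Notation h := (2^-1 : R).
Variables (g : R -> 'rV[R]_N -> 'rV[R]_N) (m l : R -> R) (r : R) (x0 : 'rV[R]_N).
Hypothesis mg : forall (y : R -> 'rV[R]_N) i,
  (forall j, continuous (fun s => y s ord0 j)) ->
  measurable_fun setT (fun s => g s (y s) ord0 i).
Hypothesis im : loc_integrable m.
Hypothesis il : loc_integrable l.
Hypothesis gml : {ae mu, forall t, forall x y,
  enorm (g t x) <= m t /\ enorm (g t x - g t y) <= l t * enorm (x - y)}.

Let ccont (y : R -> 'rV[R]_N) := forall j, continuous (fun s => y s ord0 j).
(** [weight] is a Bielecki weight: for distances measured relative to it, [step] contracts by 1/2 on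
    the whole line at once. In [rate], [N] is the cost of bounding the norm by coordinates, and
    [|m|] brings the first increment of the iteration below [weight]. *)
Let rate z := N%:R * `|l z| + `|m z|.
Let weight t := expR (2 * \int[mu]_(z in `[r, t]) rate z).
Let step (X : R -> 'rV[R]_N) t : 'rV[R]_N :=
  \row_i (x0 ord0 i + \int[mu]_(z in `[r, t]) g z (X z) ord0 i).

Let rate_ge0 z : 0 <= rate z.
Proof. by rewrite addr_ge0// mulr_ge0. Qed.

Let irate : loc_integrable rate.
Proof.
apply: loc_integrableD; last exact: loc_integrable_norm.
by apply: loc_integrableZ; exact: loc_integrable_norm.
Qed.

Let weight_continuous : continuous weight.
Proof.
move=> t; apply: continuous_comp; last exact: continuous_expR.
by apply: cvgM; [exact: cvg_cst|exact: Rintegral_itv_continuous].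
Qed.

Let irateW : loc_integrable (fun z => rate z * weight z).
Proof. exact: loc_integrableM. Qed.

Let ig X i : ccont X -> loc_integrable (fun z => g z (X z) ord0 i).
Proof.
move=> cX; apply: loc_integrable_le im _; first exact: mg.
apply: ae_leb_imp gml => t /(_ (X t) 0)[H _].
exact: le_trans (normr_coord_le_enorm _ _) H.
Qed.

Let step_primitive X : ccont X -> primitive r (fun z => g z (X z)) (step X).
Proof.
move=> cX i; split => [|t]; first exact: ig.
by rewrite !mxE set_itv1 Rintegral_set1 addr0.
Qed.

Let step_ccont X : ccont X -> ccont (step X).
Proof. by move=> cX j; exact: primitive_continuous (step_primitive cX). Qed.

Let step_dist X Y c : ccont X -> ccont Y -> 0 <= c ->
  (forall t i, `|X t ord0 i - Y t ord0 i| <= c * weight t) ->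
  forall t i, `|step X t ord0 i - step Y t ord0 i| <= c * h * weight t.
Proof.
move=> cX cY c0 H t i; rewrite !mxE.
have [rt|tr] := leP r t; last first.
  by rewrite !Rintegral_itv_gt// subrr normr0 !mulr_ge0 ?invr_ge0 ?expR_ge0.
have ->: x0 ord0 i + \int[mu]_(z in `[r, t]) g z (X z) ord0 i -
    (x0 ord0 i + \int[mu]_(z in `[r, t]) g z (Y z) ord0 i) =
    \int[mu]_(z in `[r, t]) (g z (X z) ord0 i - g z (Y z) ord0 i).
  rewrite RintegralB//; [lra|exact: ig|exact: ig].
have iB : loc_integrable (fun z => g z (X z) ord0 i - g z (Y z) ord0 i).
  by apply: loc_integrableB; exact: ig.
apply: le_trans (le_normr_Rintegral _ (iB r t)) _ => //.
apply: (@le_trans _ _ (\int[mu]_(z in `[r, t]) (c * (rate z * weight z)))).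
  apply: le_Rintegral_ae; [exact: loc_integrable_norm|exact: loc_integrableZ|].
  apply: ae_leb_imp gml => z /(_ (X z) (Y z))[_ Hz] _.
  have := normr_coord_le_enorm (g z (X z) - g z (Y z)) i; rewrite !mxE.
  move/le_trans; apply; apply: le_trans Hz _.
  apply: (@le_trans _ _ (`|l z| * (N%:R * (c * weight z)))).
    apply: (@le_trans _ _ (`|l z| * enorm (X z - Y z))).
      by rewrite ler_wpM2r ?enorm_ge0// ler_norm.
    rewrite ler_wpM2l//; apply: le_trans (enorm_le_sum _) _.
    rewrite mulr_natl -[X in _ <= _ *+ X]card_ord -sumr_const.
    by apply: ler_sum => j _; rewrite !mxE.
  have cw : 0 <= c * weight z by rewrite mulr_ge0 ?expR_ge0.
  have := mulr_ge0 (normr_ge0 (m z)) cw.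
  rewrite /rate; lra.
rewrite RintegralZl// -mulrA ler_wpM2l//.
exact: Rintegral_expR_le.
Qed.

Let xn n := iter n step (fun=> x0).

Let xn_ccont n : ccont (xn n).
Proof.
elim: n => [|n IH]; last exact: step_ccont.
by move=> j t; exact: cvg_cst.
Qed.

Let xn_dist n t i : `|xn n.+1 t ord0 i - xn n t ord0 i| <= h ^+ n * weight t.
Proof.
elim: n t i => [|n IH] t i; last first.
  rewrite exprSr.
  exact: (step_dist (@xn_ccont n.+1) (@xn_ccont n) (half_expn_ge0 n) IH).
rewrite expr0 mul1r /= mxE addrAC subrr add0r.
have i0 : loc_integrable (fun z => g z x0 ord0 i).
  by apply: (@ig (fun=> x0)) => j s; exact: cvg_cst.
apply: le_trans (le_normr_Rintegral _ (i0 r t)) _ => //.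
apply: (@le_trans _ _ (\int[mu]_(z in `[r, t]) rate z)).
  apply: le_Rintegral_ae => //; first exact: loc_integrable_norm.
  apply: ae_leb_imp gml => z /(_ x0 x0)[Hz _] _.
  apply: le_trans (normr_coord_le_enorm _ _) (le_trans Hz _).
  by rewrite (le_trans (ler_norm _))// lerDr mulr_ge0.
have := Rintegral_itv_ge0 r t rate_ge0.
have := expR_ge1Dx (2 * \int[mu]_(z in `[r, t]) rate z).
rewrite -/(weight t); lra.
Qed.

Lemma picard : exists x, x r = x0 /\ primitive r (fun z => g z (x z)) x.
Proof.
have Hlim t i : exists y, forall n, `|y - xn n t ord0 i| <= 2 * weight t * h ^+ n.
  apply: (@geometric_limit _ (fun n => xn n t ord0 i)); first exact: expR_ge0.
  by move=> n; rewrite [leRHS]mulrC; exact: xn_dist.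
pose F t := projT1 (choice (Hlim t)).
have HF t i n : `|F t i - xn n t ord0 i| <= 2 * weight t * h ^+ n.
  exact: projT2 (choice (Hlim t)) i n.
pose x t : 'rV[R]_N := \row_i F t i.
have xd n t i : `|x t ord0 i - xn n t ord0 i| <= 2 * h ^+ n * weight t.
  by rewrite mxE mulrAC; exact: HF.
have cx : ccont x.
  move=> i t; apply/cvgrPdist_le => e e0.
  have e3 : 0 < e / 3 by rewrite divr_gt0.
  (* Near [t] the weight stays below [weight t + 1], so one [n] makes the iterate uniformly close to
     the limit and continuity passes to [x]. *)
  have [n ne] := half_expn_small (2 * (weight t + 1)) e3.
  have /cvgrPdist_le /(_ _ e3) H1 := @xn_ccont n i t.
  have wt : weight t < weight t + 1 by rewrite -[ltLHS]addr0; exact: ler_ltD.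
  have H2 : \forall s \near t, weight s < weight t + 1.
    exact: (@weight_continuous t _ (lt_nbhsl wt)).
  apply: filterS2 H1 H2 => s H1 H2.
  have xs := le_trans (xd n s i) (half_expn_bound ne (ltW H2)).
  have xt := le_trans (xd n t i) (half_expn_bound ne (ltW wt)).
  exact: dist3_le xs xt H1.
(* Both [x] and [step x] are within [h ^+ n * weight t] of the iterate [n.+1], the second by
   contraction; let [n] grow. *)
have xE : x = step x.
  apply/funext => t; apply/rowP => i; apply/eqP; rewrite -subr_eq0 -normr_le0.
  apply: (@le_half_expn _ _ (2 * weight t)) => n.
  have A := xd n.+1 t i.
  have c0 : 0 <= 2 * h ^+ n by rewrite mulr_ge0// half_expn_ge0.
  have D s j : `|xn n s ord0 j - x s ord0 j| <= 2 * h ^+ n * weight s.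
    by rewrite distrC; exact: xd.
  have B : `|xn n.+1 t ord0 i - step x t ord0 i| <= 2 * h ^+ n * h * weight t.
    exact: (step_dist (@xn_ccont n) cx c0 D).
  have -> : x t ord0 i - step x t ord0 i = (x t ord0 i - xn n.+1 t ord0 i) +
    (xn n.+1 t ord0 i - step x t ord0 i) by rewrite addrA subrK.
  apply: le_trans (ler_normD _ _) _; apply: le_trans (lerD A B) _.
  by move: (weight t) => w; rewrite exprS; lra.
exists x; split.
  by rewrite xE; apply/rowP => i; rewrite mxE set_itv1 Rintegral_set1 addr0.
by rewrite {2}xE; exact: step_primitive.
Qed.

End Picard.

(** * Global existence *)

Section Retraction.
Context {R : realType} {N : nat}.
Variable M : R.
Hypothesis M1 : 1 <= M.
Implicit Types x y : 'rV[R]_N.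

(** Dividing by this factor is the nearest-point projection onto the ball of radius [M]; the maximum
    treats inside and outside in one continuous formula. *)
Definition rfactor x : R := Num.max 1 (enorm x / M).
Definition retract x : 'rV[R]_N := (rfactor x)^-1 *: x.

Let M0 : 0 < M. Proof. exact: lt_le_trans M1. Qed.

Lemma rfactor_ge1 x : 1 <= rfactor x.
Proof. by rewrite le_max lexx. Qed.

Lemma rfactor_gt0 x : 0 < rfactor x.
Proof. exact: lt_le_trans (rfactor_ge1 x). Qed.

Lemma rfactor_le x : rfactor x <= 1 + enorm x ^+ 2.
Proof.
rewrite ge_max lerDl sqr_ge0/=; apply: (@le_trans _ _ (enorm x)).
  by rewrite ler_pdivrMr// ler_peMr// enorm_ge0.
have := sqr_ge0 (enorm x - 2^-1); rewrite sqrrB; lra.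
Qed.

Lemma retractK x : x = rfactor x *: retract x.
Proof. by rewrite scalerA divff ?scale1r// gt_eqF// rfactor_gt0. Qed.

Lemma enorm_retract x : enorm (retract x) = enorm x / rfactor x.
Proof. by rewrite enormZ mulrC ger0_norm// invr_ge0 ltW// rfactor_gt0. Qed.

Lemma enorm_retract_le x : enorm (retract x) <= M.
Proof.
rewrite enorm_retract ler_pdivrMr ?rfactor_gt0// mulrC -ler_pdivrMr//.
by rewrite le_max lexx orbT.
Qed.

Lemma retract_id x : enorm x <= M -> retract x = x.
Proof.
move=> xM; rewrite /retract /rfactor max_l ?invr1 ?scale1r//.
by rewrite ler_pdivrMr// mul1r.
Qed.

(** The variational inequality of the projection. The vector x - retract x is a nonnegative multiple
    of [retract x], which has norm [M] unless the multiple is 0, so Cauchy-Schwarz concludes. *)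
Lemma retract_obtuse x y : enorm y <= M -> 0 <= edot (x - retract x) (retract x - y).
Proof.
move=> yM; have -> : x - retract x = (rfactor x - 1) *: retract x.
  by rewrite scalerBl -retractK scale1r.
rewrite edotZl; have [l1|l1] := eqVneq (rfactor x) 1.
  by rewrite l1 subrr mul0r.
rewrite mulr_ge0 ?subr_ge0 ?rfactor_ge1// edotBr -sqr_enorm subr_ge0.
apply: le_trans (edot_le_enorm _ _) _; rewrite expr2 ler_wpM2l ?enorm_ge0//.
suff -> : enorm (retract x) = M by [].
have lE : rfactor x = enorm x / M.
  by move: l1; rewrite /rfactor; case: leP => // _; rewrite eqxx.
have x0 : enorm x != 0.
  by apply: contraTneq (rfactor_gt0 x) => x0; rewrite lE x0 mul0r ltxx.
by rewrite enorm_retract lE invf_div mulrCA divff// mulr1.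
Qed.

Lemma retract_lipschitz x y : enorm (retract x - retract y) <= enorm (x - y).
Proof.
have A := retract_obtuse x (enorm_retract_le y).
have B := retract_obtuse y (enorm_retract_le x).
set p := retract x in A B *; set q := retract y in A B *.
(* Adding [A] and [B] bounds the square of |p - q| by the product of x - y with p - q. *)
have H : enorm (p - q) ^+ 2 <= enorm (x - y) * enorm (p - q).
  apply: le_trans (edot_le_enorm _ _); rewrite sqr_enorm.
  move: A B; rewrite !edotBl !edotBr [edot q p]edotC; lra.
have [->|pq] := eqVneq (enorm (p - q)) 0; first exact: enorm_ge0.
by move: H; rewrite expr2 ler_pM2r// lt_neqAle eq_sym pq enorm_ge0.
Qed.

Lemma retract_continuous : continuous retract.
Proof.
move=> x; apply: (@cvg_coord _ _ _ (nbhs x)) => i.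
under eq_fun do rewrite mxE; rewrite mxE.
apply: (cvgM (F := nbhs x)); last exact: coord_continuous.
apply: (cvgV (F := nbhs x)); first by rewrite gt_eqF// rfactor_gt0.
apply: (@continuous_max _ _ (fun=> 1) (fun y : 'rV[R]_N => enorm y / M) x); first exact: cst_continuous.
by apply: (cvgM (F := nbhs x)); [exact: continuous_enorm|exact: cvg_cst].
Qed.

End Retraction.

(** * A priori bound and gluing of retracted solutions *)

Section Existence.
Context {R : realType} {N : nat}.
Local Notation mu := (@lebesgue_measure R).
Variables (f : R -> 'rV[R]_N -> 'rV[R]_N) (a b : R -> R).
Hypothesis fLC : LC f.
Hypothesis fH1 : H1 f a b.

Let ia : loc_integrable a. Proof. by case: fH1. Qed.
Let ib : loc_integrable b. Proof. by case: fH1 => _ []. Qed.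
Let b0 t : 0 <= b t. Proof. by case: fH1 => _ [_ []]. Qed.

Lemma retracted_solution M r (x0 : 'rV[R]_N) : 1 <= M ->
  exists x, x r = x0 /\ primitive r (fun z => f z (retract M (x z))) x.
Proof.
move=> M1; have [m [l [im il H]]] := LC_eball M fLC.
apply: (@picard R N (fun z y => f z (retract M y)) m (fun z => `|l z|)) => //.
- move=> y i cy; apply: (@measurable_borel_comp _ _ f (fun s => retract M (y s))).
    by case: fLC.
  move=> s; apply: (@cvg_comp _ _ _ y (retract M)); last exact: retract_continuous.
  by apply: (@cvg_coord _ _ _ (nbhs s)) => j; exact: cy.
- exact: loc_integrable_norm.
- apply: ae_leb_imp H => t Ht x y.
  have [Hm Hl] := Ht _ _ (enorm_retract_le M1 x) (enorm_retract_le M1 y).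
  split => //; apply: le_trans Hl _.
  apply: (@le_trans _ _ (`|l t| * enorm (retract M x - retract M y))).
    by rewrite ler_wpM2r ?enorm_ge0// ler_norm.
  by rewrite ler_wpM2l// retract_lipschitz.
Qed.

Let growth z := `|a z| + b z.
Let igrowth : loc_integrable growth.
Proof. by apply: loc_integrableD => //; exact: loc_integrable_norm. Qed.
Let growth_ge0 z : 0 <= growth z.
Proof. by rewrite addr_ge0. Qed.

(** Bounds the squared norm of every retracted solution. It does not involve the radius, so the
    radius can be chosen from it afterwards. *)
Let bnd r (x0 : 'rV[R]_N) t := expR (\int[mu]_(z in `[r, t]) growth z) *
  (enorm x0 ^+ 2 + \int[mu]_(z in `[r, t]) b z).

Let bnd_ge0 r x0 t : 0 <= bnd r x0 t.
Proof. by rewrite mulr_ge0 ?expR_ge0// addr_ge0 ?sqr_ge0// Rintegral_itv_ge0. Qed.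

Let bnd_le r x0 s t : r <= s -> s <= t -> bnd r x0 s <= bnd r x0 t.
Proof.
move=> rs st; rewrite ler_pM ?expR_ge0 ?addr_ge0 ?sqr_ge0 ?Rintegral_itv_ge0//.
  by rewrite ler_expR (Rintegral_itvD igrowth rs st) lerDl Rintegral_itv_ge0.
by rewrite lerD2l (Rintegral_itvD ib rs st) lerDl Rintegral_itv_ge0.
Qed.

(** Write x = c y with y the retraction and c = [rfactor]. Then 2<f(y), x> is c times 2<f(y), y>,
    hence at most c (a |y|^2 + b). As 1 <= c <= 1 + |x|^2, this is at most (|a| + b)|x|^2 + b. *)
Let retracted_bound M r x0 x t : 1 <= M -> x r = x0 ->
  primitive r (fun z => f z (retract M (x z))) x -> r <= t ->
  enorm (x t) ^+ 2 <= bnd r x0 t.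
Proof.
move=> M1 xr px rt; rewrite /bnd mulrDr -xr.
apply: (primitive_energy_le px (lexx r) rt igrowth ib) => //; last first.
  move=> z /andP[rz zt]; rewrite ler_expR (Rintegral_itvD igrowth rz zt) lerDr.
  exact: Rintegral_itv_ge0.
apply: ae_leb_imp (H1_everywhere fLC fH1) => z Hz _.
set y := retract M (x z); have {}Hz := Hz y.
have l1 := rfactor_ge1 M (x z); have l2 := rfactor_le M1 (x z).
have l0 := rfactor_gt0 M (x z).
rewrite {1}(retractK M (x z)) edotZr -/y.
have -> : enorm (x z) ^+ 2 = rfactor M (x z) ^+ 2 * enorm y ^+ 2.
  by rewrite -exprMn enorm_retract mulrCA divff ?mulr1// gt_eqF.
rewrite mulrCA; apply: (@le_trans _ _ (rfactor M (x z) * (a z * enorm y ^+ 2 + b z))).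
  by rewrite ler_pM2l.
rewrite mulrDr /growth mulrDl -addrA lerD//.
  rewrite mulrA [leRHS]mulrA.
  apply: ler_wpM2r; first exact: sqr_ge0.
  apply: (@le_trans _ _ (rfactor M (x z) * `|a z|)).
    by rewrite ler_wpM2l ?ler_norm// ltW.
  by rewrite mulrC ler_wpM2l// expr2 ler_peMl// ltW.
rewrite mulrC -[X in _ <= _ + X]mulr1 -mulrDr ler_wpM2l// addrC.
apply: le_trans l2 _; rewrite lerD2l.
by rewrite {1}(retractK M (x z)) enormZ exprMn -/y ger0_norm// ltW.
Qed.

Lemma solution_exists r (x0 : 'rV[R]_N) : exists x, is_solution f r x0 x.
Proof.
(* The added 1 gives M >= 1, so that |x|^2 <= bnd <= M <= M^2: up to time [t] the solution stays
   where the retraction is the identity. *)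
pose M t := 1 + bnd r x0 t.
have M1 t : 1 <= M t by rewrite lerDl.
have [X HX] := choice (fun t => retracted_solution r x0 (M1 t)).
have XM t s : r <= s -> s <= t -> enorm (X t s) <= M t.
  move=> rs st; have [Xr pX] := HX t.
  rewrite -(@ler_pXn2r _ 2)// ?nnegrE ?enorm_ge0// ?(le_trans ler01)//.
  apply: le_trans (retracted_bound (M1 t) Xr pX rs) _.
  apply: le_trans (bnd_le x0 rs st) _.
  by rewrite (@le_trans _ _ (M t)) ?lerDr// expr2 ler_peMl// (le_trans ler01).
have MM s t : r <= s -> s <= t -> M s <= M t by move=> rs st; rewrite lerD2l bnd_le.
have XX s t : r <= s -> s <= t -> X s s = X t s.
  move=> rs st; have [C C0 HC] := LC_solutions_dist (M t) fLC rs.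
  have [Xr pX] := HX t; have [Yr pY] := HX s.
  have := HC _ _ _ _ pY pX; rewrite Xr Yr subrr enorm0 expr0n mulr0 => H.
  apply/eqP; rewrite -subr_eq0; apply/eqP/enorm_eq0/eqP.
  rewrite -sqrf_eq0 eq_le sqr_ge0 andbT; apply: H => z /andP[rz zs].
    by rewrite !retract_id//; apply: XM => //; exact: le_trans st.
  split; last by apply: XM => //; exact: le_trans st.
  exact: le_trans (XM _ _ rz zs) (MM _ _ rs st).
(* [X t] solves the equation up to time [t] only; by [XX] solutions with different horizons agree,
   so the diagonal solves it for all times. *)
exists (fun t => X t t); split; first by case: (HX r).
move=> t rt i; have [Xr pX] := HX t; have [iX XE] := pX i.
have E z : z \in `[r, t]%classic ->
    f z (X z z) ord0 i = f z (retract (M t) (X t z)) ord0 i.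
  rewrite inE /= in_itv/= => /andP[rz zt].
  by rewrite (XX z t)// retract_id//; exact: XM.
split; last by rewrite XE Xr; congr (_ + _); apply: eq_Rintegral => z /E.
have := iX r t; apply: eq_integrable => // z /E /= ->.
by [].
Qed.

End Existence.

(** * Pullback attractors *)

Lemma compact_nested_nonempty (T : topologicalType) (F : nat -> set T) :
  hausdorff_space T -> (forall n, compact (F n)) -> (forall n, F n !=set0) ->
  (forall n, F n.+1 `<=` F n) -> exists x, forall n, F n x.
Proof.
move=> hT cF nF dF.
have mF m n : (m <= n)%N -> F n `<=` F m.
  elim: n => [|n IH]; first by rewrite leqn0 => /eqP ->.
  rewrite leq_eqVlt => /predU1P[->//|]; rewrite ltnS => /IH.
  exact: subset_trans (dF n).
(* A cluster point of the filter generated by the decreasing sets lies in each of them, since each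
   is closed. *)
pose G := filter_from [set: nat] F.
have GF : ProperFilter G.
  apply: filter_from_proper => [|n _]; last exact: nF.
  apply: filter_from_filter; first by exists 0%N.
  move=> i j _ _; exists (maxn i j) => // x Fx.
  by split; apply: mF Fx; rewrite ?leq_maxl ?leq_maxr.
have [x [_ clx]] := cF 0%N G GF (ex_intro2 _ _ 0%N I (@subset_refl _ (F 0%N))).
exists x => n; apply: (compact_closed hT (cF n)) => A nA.
exact: clx (ex_intro2 _ _ n I (@subset_refl _ (F n))) nA.
Qed.

Section Attractor.
Context {R : realType} {N : nat}.
Variables (S : R -> R -> 'rV[R]_N -> 'rV[R]_N) (rho : R).
Let B := [set x : 'rV[R]_N | enorm x <= rho].
Hypothesis S_cocycle : forall r s t x, r <= s -> s <= t ->
  S t r x = S t s (S s r x).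
Hypothesis S_continuous : forall s t, s <= t -> continuous (S t s).
Hypothesis S_absorb : forall D, ebounded D -> exists T : R, 0 < T /\
  forall t s : R, T <= s -> S t (t - s) @` D `<=` B.

Let hV : hausdorff_space 'rV[R]_N.
Proof. exact: norm_hausdorff. Qed.

Let A t := \bigcap_(s in [set s | s <= t]) (S t s @` B).

Let eB : ebounded B. Proof. by exists rho. Qed.

Let S_absorb_le D T t s : (forall t s : R, T <= s -> S t (t - s) @` D `<=` B) ->
  s <= t - T -> S t s @` D `<=` B.
Proof.
move=> H st; have := H t (t - s); rewrite subKr; apply.
by rewrite lerBrDr addrC -lerBrDr.
Qed.

Let S_compact s t : s <= t -> compact (S t s @` B).
Proof.
move=> st; apply: continuous_compact; last exact: compact_eball.
exact/continuous_subspaceT/S_continuous.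
Qed.

Let S_closed s t : s <= t -> closed (S t s @` B).
Proof. by move=> st; apply: compact_closed => //; exact: S_compact. Qed.

Lemma attractor_from_absorbing : exists A, bounded_pullback_attractor S A.
Proof.
have [T [T0 HT]] := S_absorb eB.
(* The images of [B] are nested only for starting times at least [T] apart, because [B] needs the
   time [T] to return into itself. The times t - nT therefore replace all s <= t, as [Anat]
   records. *)
have nested r s t : s <= t -> r <= s - T -> S t r @` B `<=` S t s @` B.
  move=> st rs _ [x Bx <-].
  have rs' : r <= s by apply: le_trans rs _; rewrite lerBlDr lerDl ltW.
  exists (S s r x); last by rewrite -S_cocycle.
  by apply: (S_absorb_le HT rs); exists x.
have nT (n : nat) t : t - n%:R * T <= t by rewrite lerBlDr lerDl mulr_ge0// ltW.
have nTS (n : nat) t : t - n.+1%:R * T <= t - n%:R * T - T.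
  by rewrite -addrA -opprD -{3}(mul1r T) -mulrDl natr1.
have far r t : exists n : nat, t - n%:R * T <= r.
  pose n := (Num.trunc ((t - r) / T)).+1.
  exists n; rewrite lerBlDr -lerBlDl -ler_pdivrMr//.
  by apply: ltW; exact: truncnS_gt.
have Anat t x : (forall n : nat, (S t (t - n%:R * T) @` B) x) -> A t x.
  move=> H s /= st; have [n nr] := far (s - T) t.
  exact: (nested _ _ _ st nr _ (H n)).
have AB t : A t `<=` B.
  move=> x /(_ (t - T)) Ax; apply: (S_absorb_le HT (lexx (t - T))); apply: Ax.
  by rewrite /= lerBlDr lerDl ltW.
have attr D : ebounded D -> forall t (e : R), 0 < e -> exists s0, forall s, s <= s0 ->
    forall x, (S t s @` D) x -> exists2 y, A t y & enorm (x - y) < e.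
  move=> eD t e e0; have [TD [TD0 HD]] := S_absorb eD.
  pose U := \bigcup_(y in A t) [set x : 'rV[R]_N | enorm (x - y) < e].
  have oU : open U.
    apply: bigcup_open => y _.
    apply: (@open_comp _ _ (fun x : 'rV[R]_N => enorm (x - y)) [set r : R | r < e]).
      move=> x _.
      apply: (@cvg_comp _ _ _ (fun x : 'rV[R]_N => x - y) (@enorm R N) (nbhs x)
        (nbhs (x - y))); last exact: continuous_enorm.
      apply: (@cvg_coord _ _ _ (nbhs x)) => i; rewrite !mxE.
      under eq_fun do rewrite !mxE.
      by apply: cvgB; [exact: coord_continuous|exact: cvg_cst].
    exact: open_lt.
  (* Otherwise the parts of these nested compact images outside the open neighbourhood [U] of [A t]
     would have a common point, which lies in [A t] and hence in [U]. *)
  have [n nU] : exists n : nat, S t (t - n%:R * T) @` B `<=` U.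
    apply: contrapT => nU.
    have [|n|n|n|z Hz] := @compact_nested_nonempty _
      (fun n : nat => (S t (t - n%:R * T) @` B) `&` ~` U).
    - exact: hV.
    - apply: (subclosed_compact _ (S_compact (nT n t))); last exact: subIsetl.
      by apply: closedI; [exact: S_closed|exact: open_closedC].
    - apply: contrapT => H; apply: nU; exists n => x Sx.
      by apply: contrapT => nUx; apply: H; exists x.
    - by apply: setSI; apply: nested => //; exact: nTS.
    have Az : A t z by apply: Anat => n; case: (Hz n).
    by have [_] := Hz 0%N; apply; exists z => //=; rewrite subrr enorm0.
  (* The further delay [TD] brings [D] into [B] by time t - nT; the cocycle property does the
     rest. *)
  exists (t - n%:R * T - TD) => s ss x [d Dd <-].
  have st' : s <= t - n%:R * T by apply: le_trans ss _; rewrite lerBlDr lerDl ltW.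
  have [y Ay ey] : U (S t s d).
    apply: nU; exists (S (t - n%:R * T) s d); last by rewrite -S_cocycle.
    by apply: (S_absorb_le HD ss); exists d.
  by exists y.
exists A; split; last first.
  by exists rho => x [t _]; exact: AB.
split; [|split; [|split]].
- move=> t; apply: (subclosed_compact _ (S_compact (lexx t))).
    by apply: closed_bigI => s /= st; exact: S_closed.
  by apply: bigcap_inf => /=.
- move=> t s st; apply/seteqP; split => [_ [x Ax <-]|y Ay].
    apply: Anat => n; have [k kr] := far (t - n%:R * T - T) s.
    apply: (nested (s - k%:R * T) _ _ (nT n t) kr).
    have [z Bz <-] := Ax (s - k%:R * T) (nT k s).
    by exists z => //; rewrite -S_cocycle.
  (* For [y] in [A t], the preimages of [y] inside the images of [B] at time [s] are nonempty nested
     compact sets; a common point lies in [A s] and is sent to [y]. *)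
  have [|n|n|n|z Hz] := @compact_nested_nonempty _
      (fun n : nat => (S s (s - n%:R * T) @` B) `&` [set x | S t s x = y]).
  - exact: hV.
  - apply: (subclosed_compact _ (S_compact (nT n s))); last exact: subIsetl.
    apply: closedI; first exact: S_closed.
    apply: (@closed_comp _ _ (S t s) [set y]).
      by move=> x _; exact: S_continuous.
    exact/accessible_closed_set1/hausdorff_accessible.
  - have [z Bz zy] := Ay (s - n%:R * T) (le_trans (nT n s) st).
    exists (S s (s - n%:R * T) z); split; first by exists z.
    by rewrite /= -S_cocycle.
  - by apply: setSI; apply: nested => //; exact: nTS.
  exists z; last by case: (Hz 0%N).
  by apply: Anat => n; case: (Hz n).
- move=> D eD t W [e /= e0 We].
  have e2 : 0 < e / 2 by rewrite divr_gt0.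
  have [s0 H] := attr D eD t _ e2.
  exists s0; split; first exact: num_real.
  move=> s /ltW /H Hs.
  have h0 : (0 <= hsemidist (S t s @` D) (A t))%E.
    by apply: ereal_sup_ubound; left.
  have he : (hsemidist (S t s @` D) (A t) <= (e / 2)%:E)%E.
    apply: ge_ereal_sup => _ [->|[x Sx <-]]; first by rewrite lee_fin ltW.
    have [y Ay xy] := Hs x Sx.
    apply: (@le_trans _ _ (enorm (x - y))%:E); last by rewrite lee_fin ltW.
    by apply: ereal_inf_lbound; exists y.
  rewrite /=; move: h0 he; case: (hsemidist _ _) => [d| |]//.
  rewrite !lee_fin => d0 de; apply: We => /=.
  rewrite sub0r normrN ger0_norm//; apply: le_lt_trans de _.
  by rewrite ltr_pdivrMr// ltr_pMr// ltr1n.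
(* Minimality: [y] belongs to S(t, s)B for every s <= t, and these sets approach [C t], so [y] is in
   the closure of [C t]. *)
- move=> C cC aC t y Ay; apply: cC => W /enorm_near0[e e0 yW].
  have ne : nbhs (0%E : \bar R) [set z | (z < e%:E)%E].
    exists e => //= r; rewrite /= sub0r normrN lte_fin.
    exact: le_lt_trans (ler_norm r).
  have [s0 [_ Hs]] := aC B eB t _ ne.
  pose s := Num.min t (s0 - 1).
  have ss0 : s < s0 by rewrite gt_min ltrBlDr ltrDl ltr01 orbT.
  have st : s <= t by rewrite ge_min lexx.
  have Hy : (ereal_inf [set (enorm (y - c))%:E | c in C t] < e%:E)%E.
    apply: le_lt_trans (Hs s ss0); apply: ereal_sup_ubound; right.
    by exists y => //; exact: Ay.
  have [_ [c Cc <-]] := ereal_inf_lt Hy.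
  by rewrite lte_fin => yc; exists c; split => //; exact: yW.
Qed.

End Attractor.

(** * The process of the equation *)

Section Translation.
Context {R : realType}.
Local Notation mu := (@lebesgue_measure R).

Lemma lebesgue_measure_shift (t : R) (A : set (measurableTypeR R)) : measurable A ->
  mu A = mu ((fun s : R => s + t) @^-1` A).
Proof.
move=> mA.
have mphi : measurable_fun setT ((fun s : R => s + t) : measurableTypeR R -> measurableTypeR R).
  by apply: continuous_measurable_fun => s; apply: cvgD; [exact: cvg_id|exact: cvg_cst].
pose phi : {mfun (measurableTypeR R) >-> (measurableTypeR R)} :=
  HB.pack ((fun s : R => s + t) : measurableTypeR R -> measurableTypeR R)
    (isMeasurableFun.Build _ _ _ _ _ mphi).
(* By uniqueness of Lebesgue measure, its image under translation need only be compared with it on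
   half-open intervals. *)
apply: (@lebesgue_measure_unique R (pushforward mu phi)) => // X [[a b] _ <-].
transitivity (mu `]a - t, b - t]%classic); last first.
  congr (mu _); apply/seteqP.
  by split => s /=; rewrite !in_itv/= ltrBlDr lerBrDr.
rewrite !lebesgue_measure_itv/= !lte_fin ltrD2r.
by case: ifP => // _; rewrite -!EFinB; congr EFin; lra.
Qed.

(** Turns the hypothesis (H3) into a bound on the integral over a moving window. *)
Lemma Rintegral_shift (b : R -> R) (r t : R) : loc_integrable b ->
  (forall z, 0 <= b z) ->
  \int[mu]_(s in `[- r, r]) b (s + t) = \int[mu]_(s in `[t - r, t + r]) b s.
Proof.
move=> ib b0.
have mphi : measurable_fun setT ((fun s : R => s + t) : measurableTypeR R -> measurableTypeR R).
  by apply: continuous_measurable_fun => s; apply: cvgD; [exact: cvg_id|exact: cvg_cst].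
pose phi : {mfun (measurableTypeR R) >-> (measurableTypeR R)} :=
  HB.pack ((fun s : R => s + t) : measurableTypeR R -> measurableTypeR R)
    (isMeasurableFun.Build _ _ _ _ _ mphi).
congr fine.
have -> : `[- r, r]%classic = phi @^-1` `[t - r, t + r]%classic.
  by apply/seteqP; split => s /=; rewrite !in_itv/= => /andP[? ?]; apply/andP; split; lra.
rewrite -(@ge0_integral_pushforward _ _ _ _ R phi mphi mu _ (EFin \o b))//.
- by apply: eq_measure_integral => A mA _; exact/esym/lebesgue_measure_shift.
- exact: measurable_int (ib _ _).
- by move=> y _; rewrite /= lee_fin.
Qed.

End Translation.

(** * Cocycle, continuity and absorption *)

Section Process.
Context {R : realType} {N : nat}.
Local Notation mu := (@lebesgue_measure R).
Variables (f : R -> 'rV[R]_N -> 'rV[R]_N) (a b : R -> R).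
Hypothesis fLC : LC f.
Hypothesis fH1 : H1 f a b.
Variables (a1 K : R).
Hypothesis a1_gt0 : 0 < a1.
Hypothesis K_ge1 : 1 <= K.
Hypothesis aK : forall s t : R, s <= t ->
  expR (\int[mu]_(z in `[s, t]) a z) <= K * expR (- a1 * (t - s)).

Let ia : loc_integrable a. Proof. by case: fH1. Qed.
Let ib : loc_integrable b. Proof. by case: fH1 => _ []. Qed.
Let b0 t : 0 <= b t. Proof. by case: fH1 => _ [_ []]. Qed.
Let K_gt0 : 0 < K. Proof. exact: lt_le_trans K_ge1. Qed.

(** Global existence excludes the default branch of [Sf]. The solution is the chosen one, so later
    identities between values of [Sf] rest on uniqueness. *)
Lemma Sf_solution r (x0 : 'rV[R]_N) :
  exists2 x, is_solution f r x0 x & forall t, Sf f t r x0 = x t.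
Proof.
rewrite /Sf; case: pselect => [e|]; last by have := solution_exists fLC fH1 r x0.
by exists (proj1_sig (cid e)) => //; exact: proj2_sig (cid e).
Qed.

Lemma solution_energy r (x0 : 'rV[R]_N) x s t : is_solution f r x0 x -> r <= s -> s <= t ->
  enorm (x t) ^+ 2 <= K * expR (- a1 * (t - s)) * enorm (x s) ^+ 2
    + K * \int[mu]_(z in `[s, t]) b z.
Proof.
move=> /solution_primitive[v [y [py yr yx]]] rs st.
have [xs _] := yx s rs; have [xt _] := yx t (le_trans rs st).
rewrite -xs -xt.
have := @primitive_energy_le _ _ _ _ _ a b K s t py rs st ia ib b0.
move=> /(_ _ _)/le_trans; apply.
- apply: ae_leb_imp (H1_everywhere fLC fH1) => z Hz /andP[sz zt].
  by have [-> ->] := yx z (le_trans rs sz); exact: Hz.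
- move=> z /andP[sz zt]; apply: le_trans (aK zt) _.
  rewrite ler_piMr// ?(ltW K_gt0)// expR_le1 mulNr oppr_le0.
  by rewrite mulr_ge0 ?subr_ge0// ltW.
- by rewrite lerD2r ler_wpM2r ?sqr_ge0// aK.
Qed.

Lemma solution_bound r (x0 : 'rV[R]_N) x s t : is_solution f r x0 x -> r <= s -> s <= t ->
  enorm (x s) <= 1 + K * enorm x0 ^+ 2 + K * \int[mu]_(z in `[r, t]) b z.
Proof.
move=> sx rs st; set c := (X in _ <= X).
have I0 := Rintegral_itv_ge0 r t b0.
have c1 : 1 <= c.
  by rewrite /c -addrA lerDl addr_ge0// mulr_ge0 ?sqr_ge0// ltW.
suff : enorm (x s) ^+ 2 <= c.
  move=> H; rewrite -(@ler_pXn2r _ 2)// ?nnegrE ?enorm_ge0// ?(le_trans ler01)//.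
  by apply: le_trans H _; rewrite expr2 ler_peMl// (le_trans ler01).
apply: le_trans (solution_energy sx (lexx r) rs) _.
have [-> _] := sx; rewrite /c lerD//.
  rewrite -[leLHS]add0r lerD// ler_wpM2r ?sqr_ge0//.
  rewrite ler_piMr// ?(ltW K_gt0)// expR_le1 mulNr oppr_le0.
  by rewrite mulr_ge0 ?subr_ge0// ltW.
by rewrite ler_pM2l// (Rintegral_itvD ib rs st) lerDl Rintegral_itv_ge0.
Qed.

(** All solutions starting in the ball of radius [m] stay up to time [t] in one common ball, on
    which a single Lipschitz rate serves. *)
Lemma solution_dist (m r t : R) : r <= t -> exists2 C, 0 <= C &
  forall (x0 y0 : 'rV[R]_N) x y, is_solution f r x0 x -> is_solution f r y0 y ->
    enorm x0 <= m -> enorm y0 <= m ->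
    enorm (x t - y t) ^+ 2 <= C * enorm (x0 - y0) ^+ 2.
Proof.
move=> rt.
have [C C0 HC] := LC_solutions_dist
  (1 + K * m ^+ 2 + K * \int[mu]_(z in `[r, t]) b z) fLC rt.
exists C => // x0 y0 x y sx sy xm ym.
have [v [x' [px xr xx]]] := solution_primitive sx.
have [w [y' [py yr yy]]] := solution_primitive sy.
have bd (u0 : 'rV[R]_N) u z : is_solution f r u0 u -> enorm u0 <= m -> r <= z <= t ->
    enorm (u z) <= 1 + K * m ^+ 2 + K * \int[mu]_(z in `[r, t]) b z.
  move=> su um /andP[rz zt]; apply: le_trans (solution_bound su rz zt) _.
  rewrite lerD2r lerD2l ler_pM2l// ler_pXn2r// nnegrE ?enorm_ge0//.
  exact: le_trans (enorm_ge0 _) um.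
have := HC _ _ _ _ px py; rewrite xr yr.
have [-> _] := xx t rt; have [-> _] := yy t rt; apply => z /[dup] rzt /andP[rz _].
  by have [-> ->] := xx z rz; have [-> ->] := yy z rz.
have [-> _] := xx z rz; have [-> _] := yy z rz.
by split; [exact: bd sx _ _|exact: bd sy _ _].
Qed.

Lemma solution_unique r (x0 : 'rV[R]_N) x y t : is_solution f r x0 x ->
  is_solution f r x0 y -> r <= t -> x t = y t.
Proof.
move=> sx sy rt; have [C C0 HC] := solution_dist (enorm x0) rt.
have := HC _ _ _ _ sx sy (lexx _) (lexx _).
rewrite subrr enorm0 expr0n mulr0 => H; apply/eqP; rewrite -subr_eq0.
by apply/eqP/enorm_eq0/eqP; rewrite -sqrf_eq0 eq_le sqr_ge0 H.
Qed.

Lemma solution_restrict r s (x0 : 'rV[R]_N) x : is_solution f r x0 x -> r <= s ->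
  is_solution f s (x s) x.
Proof.
move=> sx rs; split => // t st i.
have [v [y [py yr yx]]] := solution_primitive sx.
have [_ /(_ t (le_trans rs st) i)[it _]] := sx.
split.
  apply: integrableS it => //; apply: subset_itvr.
  by rewrite bnd_simp.
have := primitive_sub i py rs st.
have [-> _] := yx s rs; have [-> _] := yx t (le_trans rs st).
move=> /eqP; rewrite subr_eq addrC => /eqP ->; congr (_ + _).
apply: eq_Rintegral => z; rewrite inE /= in_itv/= => /andP[sz _].
by have [_ ->] := yx z (le_trans rs sz).
Qed.

Lemma Sf_cocycle r s t (x0 : 'rV[R]_N) : r <= s -> s <= t ->
  Sf f t r x0 = Sf f t s (Sf f s r x0).
Proof.
move=> rs st; have [x sx ->] := Sf_solution r x0.
have [x' sx' ->] := Sf_solution r x0.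
rewrite -(solution_unique sx sx' rs).
have [y sy ->] := Sf_solution s (x s).
exact: solution_unique (solution_restrict sx rs) sy st.
Qed.

Lemma Sf_continuous s t : s <= t -> continuous (Sf f t s).
Proof.
move=> st x0.
have [C C0 HC] := solution_dist (enorm x0 + 1) st.
have x1 : enorm x0 < enorm x0 + 1 by rewrite ltrDl.
have near1 : \forall y \near x0, enorm y < enorm x0 + 1.
  exact: (@continuous_enorm R N x0 _ (lt_nbhsl x1)).
have cs : (fun y : 'rV[R]_N => x0 - y) @ x0 --> x0 - x0.
  apply: (@cvg_coord _ _ _ (nbhs x0)) => i; rewrite !mxE.
  under eq_fun do rewrite !mxE.
  by apply: cvgB; [exact: cvg_cst|exact: coord_continuous].
have ce : enorm (x0 - y) @[y --> x0] --> enorm (x0 - x0).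
  exact: (cvg_comp _ _ cs (@continuous_enorm R N (x0 - x0))).
have cC : C * enorm (x0 - y) ^+ 2 @[y --> x0] --> C * enorm (x0 - x0) ^+ 2.
  apply: (cvgM (F := nbhs x0)); first exact: cvg_cst.
  exact: (cvgM (F := nbhs x0) ce ce).
rewrite subrr enorm0 expr0n mulr0 in cC.
apply: (@cvg_coord _ _ _ (nbhs x0)) => i; apply/cvgrPdist_lt => e e0.
have e2 : 0 < e ^+ 2 by rewrite exprn_gt0.
have /cvgrPdist_lt /(_ _ e2) near2 := cC.
apply: filterS2 near1 near2 => y y1; rewrite sub0r normrN => y2.
have [x sx ->] := Sf_solution s x0; have [z sz ->] := Sf_solution s y.
have := HC _ _ _ _ sx sz (ltW x1) (ltW y1) => H.
have {}H := le_lt_trans H (le_lt_trans (ler_norm _) y2).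
have := normr_coord_le_enorm (x t - z t) i; rewrite !mxE => /le_lt_trans; apply.
by move: H; rewrite ltr_pXn2r// ?nnegrE ?enorm_ge0// ltW.
Qed.

Hypothesis bH3 : H3 b.

Lemma Sf_absorbing : exists rho : R, forall D : set 'rV[R]_N,
  ebounded D -> exists T : R, 0 < T /\ forall t s : R, T <= s ->
    Sf f t (t - s) @` D `<=` [set x | enorm x <= rho].
Proof.
(* Then a1 L = 2K, and K exp(-2K) <= K / (1 + 2K) <= 1/2. *)
pose L := 2 * K / a1.
have L0 : 0 < L by rewrite divr_gt0// mulr_gt0.
have L2 : 0 < L / 2 by rewrite divr_gt0.
have KL : K * expR (- a1 * L) <= 2^-1.
  rewrite mulNr expRN ler_pdivrMr ?expR_gt0//.
  have -> : a1 * L = 2 * K by rewrite /L mulrC divfK// gt_eqF.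
  by have := expR_ge1Dx (2 * K); have := K_ge1; lra.
have [Mb HMb] := bH3 L2.
have bL s t : s <= t -> t <= s + L -> \int[mu]_(z in `[s, t]) b z <= Mb.
  move=> st tL; have := HMb (s + L / 2); rewrite Rintegral_shift//.
  have -> : s + L / 2 - L / 2 = s by lra.
  have -> : s + L / 2 + L / 2 = s + L by lra.
  by apply: le_trans; rewrite (Rintegral_itvD ib st tL) lerDl Rintegral_itv_ge0.
have Mb0 : 0 <= Mb.
  by apply: le_trans (bL 0 0 _ _); rewrite ?Rintegral_itv_ge0// add0r ltW.
have KMb : 0 <= K * Mb by rewrite mulr_ge0// ltW.
have KKMb : 0 <= K * (2 * (K * Mb)) by rewrite !mulr_ge0// ltW.
(* Whole periods leave at most 2 K Mb besides a decaying term. The last incomplete period multiplies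
   by at most [K] and adds K Mb, and the 1 absorbs the decaying term. Since rho >= 1, a bound of the
   squared norm by [rho] also bounds the norm. *)
pose rho := 1 + K * (2 * (K * Mb)) + K * Mb.
have rho1 : 1 <= rho by rewrite /rho -addrA lerDl addr_ge0.
exists rho.
(* 2 K Mb is the fixed point of the recursion z -> z/2 + K Mb given by one period. *)
have decay r (x0 : 'rV[R]_N) x (n : nat) : is_solution f r x0 x ->
    enorm (x (r + n%:R * L)) ^+ 2 <= 2^-1 ^+ n * enorm x0 ^+ 2 + 2 * (K * Mb).
  move=> sx; elim: n => [|n IH].
    rewrite mul0r addr0 expr0 mul1r; have [-> _] := sx.
    by rewrite lerDl mulr_ge0.
  have rn : r <= r + n%:R * L by rewrite lerDl mulr_ge0// ltW.
  have E : r + n.+1%:R * L = r + n%:R * L + L by rewrite -natr1 mulrDl mul1r addrA.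
  have nn : r + n%:R * L <= r + n.+1%:R * L by rewrite E lerDl ltW.
  apply: le_trans (solution_energy sx rn nn) _.
  have -> : r + n.+1%:R * L - (r + n%:R * L) = L by rewrite E addrAC subrr add0r.
  have I1 : K * \int[mu]_(z in `[(r + n%:R * L), (r + n.+1%:R * L)]) b z <= K * Mb.
    by rewrite ler_pM2l// bL// E.
  have I2 := ler_wpM2r (sqr_ge0 (enorm (x (r + n%:R * L)))) KL.
  have I3 : 2^-1 * enorm (x (r + n%:R * L)) ^+ 2 <=
    2^-1 * (2^-1 ^+ n * enorm x0 ^+ 2 + 2 * (K * Mb)).
    by rewrite ler_pM2l// invr_gt0.
  apply: le_trans (lerD (le_trans I2 I3) I1) _.
  by rewrite (exprS 2^-1 n); lra.
move=> D [m Dm].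
have [n0 Hn0] := half_expn_small (K * m ^+ 2) (@ltr01 R).
(* After [n0] periods the contribution of the initial data is below 1; the successor keeps the
   absorption time positive when [n0] is 0. *)
exists (n0.+1%:R * L); split; first by rewrite mulr_gt0.
move=> t s Ts y [x0 Dx0 <-] /=.
have [x sx ->] := Sf_solution (t - s) x0.
have s0 : 0 <= s by apply: le_trans Ts; rewrite mulr_ge0// ltW.
(* The elapsed time [s] consists of [n] whole periods and a remainder shorter than [L]. *)
pose n := Num.trunc (s / L).
have sL0 : 0 <= s / L by rewrite divr_ge0// ltW.
have nle : n%:R * L <= s by rewrite -ler_pdivlMr// truncn_le.
have ngt : s < n%:R * L + L.
  by rewrite -[in X in _ + X](mul1r L) -mulrDl natr1 -ltr_pdivrMr// truncnS_gt.
have n0n : (n0 <= n)%N.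
  rewrite /n -ltnS; have : n0.+1%:R <= s / L by rewrite ler_pdivlMr.
  rewrite -truncn_ge_nat//; exact: ltnW.
have m0 : 0 <= m ^+ 2 by exact: sqr_ge0.
have x0m : enorm x0 ^+ 2 <= m ^+ 2.
  rewrite ler_pXn2r// ?nnegrE ?enorm_ge0 ?Dm//.
  exact: le_trans (enorm_ge0 x0) (Dm _ Dx0).
have nt : t - s + n%:R * L <= t by lra.
have rn : t - s <= t - s + n%:R * L by rewrite lerDl mulr_ge0// ltW.
have E1 := solution_energy sx rn nt.
have E2 := decay _ _ _ n sx.
have I1 : K * \int[mu]_(z in `[(t - s + n%:R * L), t]) b z <= K * Mb.
  by rewrite ler_pM2l// bL//; lra.
have e1 : K * expR (- a1 * (t - (t - s + n%:R * L))) <= K.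
  rewrite ler_piMr// ?(ltW K_gt0)// expR_le1 mulNr oppr_le0.
  by rewrite mulr_ge0 ?subr_ge0// ltW.
have I2 := ler_wpM2r (sqr_ge0 (enorm (x (t - s + n%:R * L)))) e1.
have hn : 2^-1 ^+ n <= 2^-1 ^+ n0 :> R.
  by apply: ler_wiXn2l; rewrite ?invr_ge0// invf_le1// ler1n.
have I3 : K * enorm (x (t - s + n%:R * L)) ^+ 2 <=
    K * (2^-1 ^+ n0 * m ^+ 2 + 2 * (K * Mb)).
  rewrite ler_pM2l//; apply: le_trans E2 _; rewrite lerD2r.
  by apply: ler_pM => //; exact: sqr_ge0.
suff : enorm (x t) ^+ 2 <= rho.
  move=> H; rewrite -(@ler_pXn2r _ 2)// ?nnegrE ?enorm_ge0// ?(le_trans ler01)//.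
  by apply: le_trans H _; rewrite expr2 ler_peMl// (le_trans ler01).
apply: le_trans E1 _; apply: le_trans (lerD (le_trans I2 I3) I1) _.
rewrite /rho lerD2r mulrDr lerD2r [_ * m ^+ 2]mulrC mulrA.
exact: ltW.
Qed.

End Process.

Theorem theorem6p7 (R : realType) (N : nat) (f : R -> 'rV[R]_N -> 'rV[R]_N)
  (alpha beta : R -> R) :
  LC f -> H1 f alpha beta -> H3 beta -> H2b alpha ->
  (exists B : set 'rV[R]_N, ebounded B /\
     forall D : set 'rV[R]_N, ebounded D ->
       exists T : R, 0 < T /\
         forall t s : R, T <= s -> Sf f t (t - s) @` D `<=` B) /\
  (exists A : R -> set 'rV[R]_N, bounded_pullback_attractor (Sf f) A).
Proof.
move=> fLC fH1 bH3 [a1 [K [a1_gt0 [K_ge1 aK]]]].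
have [rho absorb] := Sf_absorbing fLC fH1 a1_gt0 K_ge1 aK bH3.
split.
  by exists [set x | enorm x <= rho]; split => //; exists rho.
apply: (@attractor_from_absorbing R N (Sf f) rho _ _ absorb).
  by move=> r s t x; exact: (Sf_cocycle fLC fH1 a1_gt0 K_ge1 aK).
by move=> s t; exact: (Sf_continuous fLC fH1 a1_gt0 K_ge1 aK).
Qed.
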